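(* Let $U=\{x\in\mathbb{R}^3:x_3>0\}$ and let $f\in C_0^{\infty}(B_{\epsilon_1,\epsilon_2}\cap U)$ for some $1<\epsilon_1<\epsilon_2<\infty$. Let $\epsilon_1\le\epsilon\le\epsilon_2$ and let $\delta=\frac{\epsilon^2-1}{2\epsilon}$. Then the apple transform $\mathcal{A}f(r,\alpha,\beta)$ known for $0\le r\le\delta$ and for all $(\alpha,\beta)\in S^2$ determines $f$ uniquely for $1\le|x|\le\epsilon$. That is, if $f_1,f_2\in C_0^{\infty}(B_{\epsilon_1,\epsilon_2}\cap U)$ satisfy $\mathcal{A}f_1(r,\alpha,\beta)=\mathcal{A}f_2(r,\alpha,\beta)$ for all $0\le r\le\delta$ and $(\alpha,\beta)\in S^2$, then $f_1(x)=f_2(x)$ for all $1\le|x|\le\epsilon$.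
   Context: Hollow balls: $B_{a,b}=\{x\in\mathbb{R}^3: a<|x|<b\}$. $C_0^\infty(\Omega)$ denotes smooth real-valued functions with compact support in $\Omega$, extended by zero to $\mathbb{R}^3$. Polar form: $F(\rho,\theta,\varphi)=f(\rho\sin\varphi\cos\theta,\rho\sin\varphi\sin\theta,\rho\cos\varphi)$, with $\theta\in[0,2\pi]$ the azimuth and $\varphi\in[0,\pi]$ the colatitude. Rotations: $h=U(\alpha)V(\beta)\in \mathrm{SO}(3)$, where $U(\alpha)$ and $V(\beta)$ (matrices, not to be confused with the half space $U$) are the rotations about the $x_3$- and $x_2$-axis by angles $\alpha\in[0,2\pi]$, $\beta\in[0,\pi]$ respectively, so that $h(0,0,1)^T=(\sin\beta\cos\alpha,\sin\beta\sin\alpha,\cos\beta)^T$. The pair $(\alpha,\beta)$ is identified with this point of $S^2$. The action is $(h\cdot f)(x)=f(hx)$, and $h\cdot F$ is the polar form of $h\cdot f$. Apple transform: for $r\ge0$ and $(\alpha,\beta)\in S^2$, $$\mathcal{A}f(r,\alpha,\beta)=\int_{0}^{2\pi}\int_{0}^{\pi}\rho^2\sin\varphi\sqrt{\frac{1+r^2}{1+r^2\sin^2\varphi}}\,(h\cdot F)(\rho,\theta,\varphi)\Big|_{\rho=\sqrt{r^2\sin^2\varphi+1}+r\sin\varphi}\mathrm{d}\varphi\,\mathrm{d}\theta,\qquad h=U(\alpha)V(\beta).$$ *)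

(* Defs.v *)
From Stdlib Require Import Reals List.
From Coquelicot Require Import Coquelicot.

Open Scope R_scope.

Notation R3 := (R * R * R)%type.

Definition norm3 (x : R3) : R :=
  let '(x1, x2, x3) := x in sqrt (x1 ^ 2 + x2 ^ 2 + x3 ^ 2).

Definition hollow_ball (a b : R) (x : R3) : Prop := a < norm3 x < b.

Definition upper_half_space (x : R3) : Prop :=
  let '(_, _, x3) := x in 0 < x3.

Definition closure {X : UniformSpace} (A : X -> Prop) (x : X) : Prop :=
  forall P : X -> Prop, locally x P -> exists y, P y /\ A y.

Definition compact_set {X : UniformSpace} (K : X -> Prop) : Prop :=
  forall (I : Type) (O : I -> X -> Prop),
    (forall i, open (O i)) ->
    (forall x, K x -> exists i, O i x) ->
    exists l : list I, forall x, K x -> exists i, In i l /\ O i x.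

Inductive axis : Set := X1 | X2 | X3.

Definition coord (i : axis) (x : R3) : R :=
  let '(x1, x2, x3) := x in
  match i with X1 => x1 | X2 => x2 | X3 => x3 end.

Definition set_coord (i : axis) (x : R3) (t : R) : R3 :=
  let '(x1, x2, x3) := x in
  match i with X1 => (t, x2, x3) | X2 => (x1, t, x3) | X3 => (x1, x2, t) end.

Definition ex_partial (i : axis) (f : R3 -> R) (x : R3) : Prop :=
  ex_derive (fun t => f (set_coord i x t)) (coord i x).

Definition partial (i : axis) (f : R3 -> R) (x : R3) : R :=
  Derive (fun t => f (set_coord i x t)) (coord i x).

(** Meaningful for [D] open: the values of the partial derivatives at the
    points of [D] then depend only on [f] restricted to [D]. *)
Fixpoint C_n (n : nat) (D : R3 -> Prop) (f : R3 -> R) : Prop :=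
  (forall x, D x -> continuous f x) /\
  match n with
  | O => True
  | S m => forall i, (forall x, D x -> ex_partial i f x) /\ C_n m D (partial i f)
  end.

Definition smooth_on (D : R3 -> Prop) (f : R3 -> R) : Prop :=
  forall n, C_n n D f.

Definition support (f : R3 -> R) : R3 -> Prop := closure (fun x => f x <> 0).

(** The space [C_0^oo(D)]. Its elements are functions on all of [R^3]; the
    support condition forces them to vanish outside [D], so they are the
    extensions by zero of the smooth compactly supported functions on [D]. *)
Definition test_function (D : R3 -> Prop) (f : R3 -> R) : Prop :=
  smooth_on D f /\ compact_set (support f) /\ (forall x, support f x -> D x).

(** [rho] radius, [theta] azimuth, [phi] colatitude. *)
Definition polar (f : R3 -> R) (rho theta phi : R) : R :=
  f (rho * sin phi * cos theta, rho * sin phi * sin theta, rho * cos phi).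

Definition rotU (alpha : R) (x : R3) : R3 :=
  let '(x1, x2, x3) := x in
  (cos alpha * x1 - sin alpha * x2, sin alpha * x1 + cos alpha * x2, x3).

(** Oriented so that [(0, 0, 1)] goes to [(sin beta, 0, cos beta)]. *)
Definition rotV (beta : R) (x : R3) : R3 :=
  let '(x1, x2, x3) := x in
  (cos beta * x1 + sin beta * x3, x2, - sin beta * x1 + cos beta * x3).

Definition rot (alpha beta : R) (x : R3) : R3 := rotU alpha (rotV beta x).

Lemma rot_north_pole (alpha beta : R) :
  rot alpha beta (0, 0, 1)
  = (sin beta * cos alpha, sin beta * sin alpha, cos beta).
Proof. unfold rot, rotU, rotV; apply f_equal2; [apply f_equal2 |]; ring. Qed.

Definition act (h : R3 -> R3) (f : R3 -> R) (x : R3) : R := f (h x).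

Definition apple_radius (r phi : R) : R :=
  sqrt (r ^ 2 * sin phi ^ 2 + 1) + r * sin phi.

Definition apple (f : R3 -> R) (r alpha beta : R) : R :=
  RInt (fun theta =>
    RInt (fun phi =>
      let rho := apple_radius r phi in
      rho ^ 2 * sin phi * sqrt ((1 + r ^ 2) / (1 + r ^ 2 * sin phi ^ 2))
      * polar (act (rot alpha beta) f) rho theta phi)
    0 PI)
  0 (2 * PI).

(* Main.v *)
Require Import Defs.
From Stdlib Require Import Reals List Lra Lia Nsatz ClassicalEpsilon.
From Coquelicot Require Import Coquelicot.

Open Scope R_scope.

(** Let [g] be the difference of the two functions. It is continuous, vanishes
    on the ball of radius [eps1], and its apple transform vanishes for
    [r <= delta]. The heart of the matter is [apple_kernel_odd]: such a [g]
    satisfies [g x + g (- x) = 0] on the ball of radius [eps]. Since [g] also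
    vanishes below the plane [x3 = 0], the theorem follows.

    The transform integrates over a surface of revolution, so rotating [g] only
    moves the axis ([apple_rot]), and it is enough to take [x] on the [x3]-axis,
    [x = (0, 0, rho)]. For such [x] only the integrals [F_rho y] of [g] over the
    circles of latitude at height [rho * y] on the sphere of radius [rho] count
    ([latitude_int]): [F_rho 1 + F_rho (-1)] is [2 * PI] times
    [g x + g (- x)].

    To reach [F_rho], integrate the transform over all axes [(alpha, beta)]
    against [sin beta * cos beta ^ l]. An apple meets a sphere about the origin
    in circles around its axis, of some angular radius [phi], and the operator
    that averages a function on the sphere over these circles is symmetric
    ([sphere_int_symm]). It can thus be moved to the other factor, the function
    [cos beta ^ l], which it turns into a polynomial of degree [l] in
    [cos beta]. Take [l = 2 * n] and assume that the even moments of [F_rho] of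
    lower order vanish; then only the leading coefficient [Q phi] of that
    polynomial, a multiple of the Legendre polynomial of degree [l] at
    [cos phi], survives ([sphere_int_zonal]). With [s = r * sin phi], which
    determines the radius [rho], one is left with the equation
    [int_0^PI Q phi * nu (r * sin phi) dphi = 0] for [0 <= r <= delta], where
    [nu s] is the moment of order [2 * n] times a positive factor.

    This is a Volterra equation of the first kind with an Abel singularity at
    [phi = PI / 2], and [Q (PI / 2)] is not zero because [l] is even. It has
    only the zero solution ([volterra_unique]), so by induction all even moments
    of [F_rho] vanish. As [n] grows, [y ^ (2 * n)] concentrates at the two poles
    [y = 1] and [y = -1], whence [F_rho 1 + F_rho (-1) = 0]
    ([even_moments_endpoint]). *)

(** * Continuity and Riemann integrals *)

(** Continuity at every point, on an arbitrary uniform space: parameters can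
    then be added by passing to a product, which is how integrals depending on
    parameters are handled. *)
Definition cont {T U : UniformSpace} (f : T -> U) : Prop :=
  forall t, continuous f t.

Lemma cont_const {T U : UniformSpace} (c : U) : cont (fun _ : T => c).
Proof. intros t; apply continuous_const. Qed.

Lemma cont_id {T : UniformSpace} : cont (fun t : T => t).
Proof. intros t; apply continuous_id. Qed.

Lemma cont_fst {T U V : UniformSpace} (u : T -> U * V) :
  cont u -> cont (fun t => fst (u t)).
Proof.
  intros H t; apply continuous_comp; [apply H | apply continuous_fst].
Qed.

Lemma cont_snd {T U V : UniformSpace} (u : T -> U * V) :
  cont u -> cont (fun t => snd (u t)).
Proof.
  intros H t; apply continuous_comp; [apply H | apply continuous_snd].
Qed.

Lemma cont_comp {T U V : UniformSpace} (g : U -> V) (u : T -> U) :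
  cont g -> cont u -> cont (fun t => g (u t)).
Proof. intros Hg Hu t; apply continuous_comp; [apply Hu | apply Hg]. Qed.

Lemma cont_pair {T U V : UniformSpace} (u : T -> U) (v : T -> V) :
  cont u -> cont v -> cont (fun t => (u t, v t)).
Proof.
  intros Hu Hv t.
  apply (continuous_comp_2 u v (fun a b => (a, b))); [apply Hu | apply Hv |].
  apply continuous_ext with (fun p : U * V => p); [| apply continuous_id].
  now intros [a b].
Qed.

Lemma cont_comp2 {T U V W : UniformSpace} (g : U -> V -> W)
  (u : T -> U) (v : T -> V) :
  cont (fun p : U * V => g (fst p) (snd p)) -> cont u -> cont v ->
  cont (fun t => g (u t) (v t)).
Proof.
  intros Hg Hu Hv.
  apply (cont_comp (fun p : U * V => g (fst p) (snd p)) (fun t => (u t, v t)));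
    [exact Hg | now apply cont_pair].
Qed.

Lemma cont_comp3 {T : UniformSpace} (g : R -> R -> R -> R) (u v w : T -> R) :
  cont (fun p : R * R * R => g (fst (fst p)) (snd (fst p)) (snd p)) ->
  cont u -> cont v -> cont w -> cont (fun t => g (u t) (v t) (w t)).
Proof.
  intros Hg Hu Hv Hw.
  apply (cont_comp (fun p : R * R * R => g (fst (fst p)) (snd (fst p)) (snd p))
    (fun t => (u t, v t, w t))); [exact Hg |].
  now repeat apply cont_pair.
Qed.

Section RealValued.
Context {T : UniformSpace}.
Implicit Types u v : T -> R.

Lemma cont_plus u v : cont u -> cont v -> cont (fun t => u t + v t).
Proof. intros Hu Hv t; apply (continuous_plus u v t); auto. Qed.

Lemma cont_opp u : cont u -> cont (fun t => - u t).
Proof. intros Hu t; apply (continuous_opp u t); auto. Qed.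

Lemma cont_minus u v : cont u -> cont v -> cont (fun t => u t - v t).
Proof. intros Hu Hv; apply cont_plus; [| apply cont_opp]; auto. Qed.

Lemma cont_mult u v : cont u -> cont v -> cont (fun t => u t * v t).
Proof. intros Hu Hv t; apply (continuous_mult u v t); auto. Qed.

Lemma cont_pow u n : cont u -> cont (fun t => u t ^ n).
Proof.
  intros Hu; induction n as [| n IH]; simpl;
    [apply cont_const | apply cont_mult; auto].
Qed.

Lemma cont_sin u : cont u -> cont (fun t => sin (u t)).
Proof. apply cont_comp; intros x; apply continuous_sin. Qed.

Lemma cont_cos u : cont u -> cont (fun t => cos (u t)).
Proof. apply cont_comp; intros x; apply continuous_cos. Qed.

Lemma cont_sqrt u : cont u -> cont (fun t => sqrt (u t)).
Proof. apply cont_comp; intros x; apply continuous_sqrt. Qed.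

Lemma cont_abs u : cont u -> cont (fun t => Rabs (u t)).
Proof. apply cont_comp; intros x; apply continuous_Rabs. Qed.

Lemma cont_div u v :
  cont u -> cont v -> (forall t, v t <> 0) -> cont (fun t => u t / v t).
Proof.
  intros Hu Hv Hn; apply cont_mult; [exact Hu |].
  intros t; apply continuous_comp; [apply Hv |].
  apply continuous_Rinv, Hn.
Qed.

End RealValued.

Lemma ex_RInt_cont (f : R -> R) a b : cont f -> ex_RInt f a b.
Proof.
  intros H; apply (ex_RInt_continuous (V := R_CompleteNormedModule)).
  intros; apply H.
Qed.

(** An integral over a compact interval is continuous in its parameters: the
    integrand is, near a fixed parameter, uniformly close to its value there, by
    compactness of the interval. *)
Lemma cont_RInt {T : UniformSpace} (f : T -> R -> R) a b :
  cont (fun p : T * R => f (fst p) (snd p)) -> cont (fun t => RInt (f t) a b).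
Proof.
  intros Hf.
  assert (Hc : forall t, cont (f t)).
  { intros t; apply (cont_comp2 f (fun _ => t) (fun x => x) Hf).
    apply cont_const. apply cont_id. }
  enough (W : forall a b, a <= b -> cont (fun t => RInt (f t) a b)).
  { destruct (Rle_dec a b) as [L | L]; [now apply W |].
    intros t; apply continuous_ext with (fun t => - RInt (f t) b a).
    - intros s; apply (opp_RInt_swap (V := R_CompleteNormedModule)).
      now apply ex_RInt_cont.
    - apply cont_opp, W; lra. }
  clear a b; intros a b Hab t0.
  apply filterlim_locally; intros eps.
  set (e := eps / (2 * (b - a + 1))).
  assert (He : 0 < e).
  { apply Rdiv_lt_0_compat; [apply eps | lra]. }
  assert (D : forall x, exists d : posreal, forall s y,
    ball t0 d s -> ball x d y -> Rabs (f s y - f t0 x) < e).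
  { intros x; specialize (Hf (t0, x)).
    apply filterlim_locally with (eps := mkposreal e He) in Hf.
    destruct Hf as [d Hd]; exists d; intros s y Hs Hy.
    apply (Hd (s, y)); split; assumption. }
  set (delta := fun x => proj1_sig (constructive_indefinite_description _ (D x))).
  assert (Hdelta : forall x s y, ball t0 (delta x) s -> ball x (delta x) y ->
    Rabs (f s y - f t0 x) < e).
  { intros x; exact (proj2_sig (constructive_indefinite_description _ (D x))). }
  destruct (compactness_value_1d a b delta) as [d Hd].
  exists d; intros s Hs.
  assert (B : forall x, a <= x <= b -> Rabs (f s x - f t0 x) <= 2 * e).
  { intros x Hx; destruct (Rle_dec (Rabs (f s x - f t0 x)) (2 * e)); [easy |].
    exfalso; apply (Hd x Hx); intros (t & Ht & Hxt & Hdt).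
    assert (B1 : ball t (delta t) x) by exact Hxt.
    pose proof (Hdelta t s x (ball_le _ _ _ Hdt _ Hs) B1).
    pose proof (Hdelta t t0 x (ball_center _ _) B1).
    apply n; replace (f s x - f t0 x)
      with ((f s x - f t0 t) - (f t0 x - f t0 t)) by ring.
    eapply Rle_trans; [apply Rabs_triang |]; rewrite Rabs_Ropp; lra. }
  change (Rabs (RInt (f s) a b - RInt (f t0) a b) < eps).
  assert (E : RInt (f s) a b - RInt (f t0) a b
    = RInt (fun x => f s x - f t0 x) a b).
  { symmetry; apply (RInt_minus (V := R_CompleteNormedModule));
      now apply ex_RInt_cont. }
  rewrite E; eapply Rle_lt_trans;
    [apply (abs_RInt_le_const _ a b (2 * e) Hab); [| exact B] |].
  - apply ex_RInt_cont, cont_minus; auto.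
  - unfold e; destruct eps as [eps Heps]; simpl.
    apply Rlt_le_trans with ((b - a + 1) * (2 * (eps / (2 * (b - a + 1))))).
    + apply Rmult_lt_compat_r; [|lra].
      unfold e in He; simpl in He; lra.
    + right; field; lra.
Qed.

(** The last case undoes the eta-reductions that unification makes in the
    subgoals. *)
Ltac cont :=
  repeat match goal with
  | H : cont ?f |- cont ?f => exact H
  | H : forall _, cont _ |- _ => apply H
  | |- cont (fun _ => ?c) => apply cont_const
  | |- cont (fun t => t) => apply cont_id
  | |- cont (fun t => fst _) => apply cont_fst
  | |- cont (fun t => snd _) => apply cont_snd
  | |- cont fst => apply (cont_fst (fun p => p))
  | |- cont snd => apply (cont_snd (fun p => p))
  | |- cont (fun t => (_, _)) => apply cont_pair
  | |- cont (fun t => _ + _) => apply cont_plus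
  | |- cont (fun t => _ - _) => apply cont_minus
  | |- cont (fun t => _ * _) => apply cont_mult
  | |- cont (fun t => - _) => apply cont_opp
  | |- cont (fun t => _ ^ _) => apply cont_pow
  | |- cont (fun t => sin _) => apply cont_sin
  | |- cont (fun t => cos _) => apply cont_cos
  | |- cont sin => intro; apply continuous_sin
  | |- cont cos => intro; apply continuous_cos
  | |- cont (fun t => sqrt _) => apply cont_sqrt
  | |- cont (fun t => Rabs _) => apply cont_abs
  | |- cont (fun t => RInt _ _ _) => apply cont_RInt
  | H : cont (fun p => ?g (fst p) (snd p)) |- cont (fun t => ?g _ _) =>
      apply (cont_comp2 g _ _ H)
  | H : cont ?g |- cont (fun t => ?g _) => apply (cont_comp g _ H)
  | H : cont (fun p => ?g (fst (fst p)) (snd (fst p)) (snd p))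
    |- cont (fun t => ?g _ _ _) => apply (cont_comp3 g _ _ _ H)
  | |- cont ?f =>
      lazymatch f with
      | (fun _ => _) => fail
      | _ => change (cont (fun t => f t))
      end
  end.

(** Integrals are typed in canonical structures over [R], and so are equations
    between them; [ring] and [field] only recognize equations in [R] itself. *)
Ltac eqR := match goal with |- ?a = ?b => change (@eq R a b) end.

Lemma RInt_plusR (f g : R -> R) a b : cont f -> cont g ->
  RInt (fun x => f x + g x) a b = RInt f a b + RInt g a b.
Proof.
  intros Hf Hg; apply (RInt_plus (V := R_CompleteNormedModule));
    now apply ex_RInt_cont.
Qed.

Lemma RInt_minusR (f g : R -> R) a b : cont f -> cont g ->
  RInt (fun x => f x - g x) a b = RInt f a b - RInt g a b.
Proof.
  intros Hf Hg; apply (RInt_minus (V := R_CompleteNormedModule));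
    now apply ex_RInt_cont.
Qed.

Lemma RInt_scalR (f : R -> R) k a b : cont f ->
  RInt (fun x => k * f x) a b = k * RInt f a b.
Proof.
  intros Hf; apply (RInt_scal (V := R_CompleteNormedModule));
    now apply ex_RInt_cont.
Qed.

Lemma RInt_extR (f g : R -> R) a b :
  (forall x, f x = g x) -> RInt f a b = RInt g a b :> R.
Proof. intros H; apply RInt_ext; intros; apply H. Qed.

Lemma RInt_zero (f : R -> R) a b :
  (forall x, Rmin a b < x < Rmax a b -> f x = 0) -> RInt f a b = 0.
Proof.
  intros H; rewrite (RInt_ext f (fun _ => 0) a b H).
  rewrite RInt_const; apply Rmult_0_r.
Qed.

Lemma RInt_chaslesR (f : R -> R) a b c : cont f ->
  RInt f a c = RInt f a b + RInt f b c.
Proof.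
  intros Hf; symmetry; apply (RInt_Chasles (V := R_CompleteNormedModule));
    now apply ex_RInt_cont.
Qed.

Lemma RInt_swapR (f : R -> R) a b : cont f -> RInt f b a = - RInt f a b.
Proof.
  intros Hf; symmetry; apply (opp_RInt_swap (V := R_CompleteNormedModule)).
  now apply ex_RInt_cont.
Qed.

Lemma RInt_FTC (f df : R -> R) a b :
  (forall x, is_derive f x (df x)) -> cont df -> RInt df a b = f b - f a.
Proof.
  intros Hf Hdf; apply is_RInt_unique.
  apply (is_RInt_derive (V := R_CompleteNormedModule) f df); auto.
Qed.

Lemma is_derive_primitive (f : R -> R) a x :
  cont f -> is_derive (fun y => RInt f a y) x (f x).
Proof.
  intros Hf; apply (is_derive_RInt f (fun y => RInt f a y) a x); [| apply Hf].
  apply filter_forall; intros y.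
  apply (RInt_correct (V := R_CompleteNormedModule)), ex_RInt_cont, Hf.
Qed.

Lemma cont_primitive (f : R -> R) a : cont f -> cont (fun y => RInt f a y).
Proof.
  intros Hf y; apply (ex_derive_continuous (V := R_NormedModule)).
  exists (f y); now apply is_derive_primitive.
Qed.

(** As functions of the upper bound of the outer integral, both sides vanish at
    the lower bound and have the same derivative. *)
Lemma RInt_fubini (f : R -> R -> R) a b c d :
  cont (fun p : R * R => f (fst p) (snd p)) ->
  RInt (fun x => RInt (fun y => f x y) c d) a b
  = RInt (fun y => RInt (fun x => f x y) a b) c d :> R.
Proof.
  intros Hf.
  assert (Hx : forall y, cont (fun x => f x y)) by (intros; cont).
  assert (Hi : cont (fun x => RInt (fun y => f x y) c d)) by cont.
  assert (Dr : forall x, is_derive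
    (fun z => RInt (fun y => RInt (fun x => f x y) a z) c d) x
    (RInt (fun y => f x y) c d)).
  { intros x.
    assert (E : forall y u,
      Derive (fun z => RInt (fun x => f x y) a z) u = f u y).
    { intros y u; apply is_derive_unique.
      apply (is_derive_primitive (fun x => f x y)).
      apply Hx. }
    replace (RInt (fun y => f x y) c d) with (RInt (fun y =>
      Derive (fun z => RInt (fun x => f x y) a z) x) c d)
      by (apply RInt_ext; intros; apply E).
    apply (is_derive_RInt_param (fun z y => RInt (fun x => f x y) a z)).
    - apply filter_forall; intros u y _; exists (f u y).
      now apply (is_derive_primitive (fun x => f x y)).
    - intros y _; apply continuity_2d_pt_ext with f.
      + intros u v; symmetry; apply E.
      + apply continuity_2d_pt_filterlim; apply (Hf (x, y)).
    - apply filter_forall; intros u; apply ex_RInt_cont.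
      apply (cont_RInt (fun y x => f x y)); cont. }
  pose proof (RInt_FTC _ _ a b Dr Hi) as H; simpl in H; rewrite H.
  rewrite (RInt_zero (fun y => RInt (fun x => f x y) a a)); [ring |].
  intros; apply (RInt_point (V := R_CompleteNormedModule)).
Qed.

Lemma RInt_affine (f : R -> R) u v a b : cont f ->
  u * RInt (fun x => f (u * x + v)) a b = RInt f (u * a + v) (u * b + v).
Proof.
  intros Hf; rewrite <- RInt_scalR by cont.
  apply (RInt_comp_lin (V := R_CompleteNormedModule) f u v a b).
  now apply ex_RInt_cont.
Qed.

Lemma RInt_shift (f : R -> R) a b c : cont f ->
  RInt (fun x => f (x + c)) a b = RInt f (a + c) (b + c) :> R.
Proof.
  intros Hf; rewrite <- (Rmult_1_l a), <- (Rmult_1_l b).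
  rewrite <- RInt_affine, !Rmult_1_l by exact Hf.
  apply RInt_extR; intros x; now rewrite Rmult_1_l.
Qed.

Lemma RInt_period (f : R -> R) L c : cont f -> (forall x, f (x + L) = f x) ->
  RInt (fun x => f (x + c)) 0 L = RInt f 0 L :> R.
Proof.
  intros Hf HL; rewrite RInt_shift by exact Hf.
  rewrite (RInt_chaslesR f (0 + c) 0), (RInt_chaslesR f 0 L) by exact Hf.
  assert (E : RInt f L (L + c) = RInt f 0 c :> R).
  { rewrite <- (RInt_extR (fun x => f (x + L)) f 0 c HL).
    rewrite RInt_shift by exact Hf; now rewrite Rplus_0_l, (Rplus_comm c). }
  rewrite E, Rplus_0_l.
  pose proof (RInt_chaslesR f 0 c 0 Hf) as Z.
  rewrite (RInt_point (V := R_CompleteNormedModule)) in Z.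
  change zero with 0 in Z; lra.
Qed.

Lemma RInt_sin_cos (h : R -> R) : cont h ->
  RInt (fun b => sin b * h (cos b)) 0 PI = RInt h (-1) 1 :> R.
Proof.
  intros Ch.
  pose proof (RInt_comp (V := R_CompleteNormedModule) h cos (fun x => - sin x)
    0 PI) as H.
  rewrite cos_0, cos_PI in H.
  assert (E : RInt (fun y => - sin y * h (cos y)) 0 PI = RInt h 1 (-1) :> R).
  { apply H; intros x _; [apply Ch |].
    split; [apply is_derive_cos |].
    revert x; change (cont (fun x => - sin x)); cont. }
  eqR; rewrite (RInt_swapR h 1 (-1)) by exact Ch; rewrite <- E.
  replace (- RInt (fun y => - sin y * h (cos y)) 0 PI)
    with (-1 * RInt (fun y => - sin y * h (cos y)) 0 PI) by ring.
  rewrite <- RInt_scalR by cont.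
  apply RInt_extR; intros b; ring.
Qed.

(** Stated on the closed interval: at the end points only one side is
    available, so the mean value theorem replaces differentiation. *)
Lemma primitive_zero (f : R -> R) (d : R) : cont f -> 0 < d ->
  (forall x, 0 <= x <= d -> RInt f 0 x = 0) ->
  forall x, 0 <= x <= d -> f x = 0.
Proof.
  intros Cf Hd H x Hx.
  destruct (Req_dec (f x) 0) as [E | N]; [exact E | exfalso].
  assert (e0 : 0 < Rabs (f x)) by now apply Rabs_pos_lt.
  pose proof (proj1 (filterlim_locally _ _) (Cf x) (mkposreal _ e0))
    as [[r Hr] B].
  set (p := Rmax 0 (x - r / 2)); set (q := Rmin d (x + r / 2)).
  assert (Hp : 0 <= p <= x /\ x - r / 2 <= p).
  { unfold p; split; [split |]; [apply Rmax_l | apply Rmax_lub; lra |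
      apply Rmax_r]. }
  assert (Hq : x <= q <= d /\ q <= x + r / 2).
  { unfold q; split; [split |]; [apply Rmin_glb; lra | apply Rmin_l |
      apply Rmin_r]. }
  assert (Hpq : p < q).
  { unfold p, q; apply Rmax_lub_lt; apply Rmin_glb_lt; lra. }
  destruct (MVT_gen (fun y => RInt f 0 y) p q f) as (c & Hc & Ec).
  - intros; now apply is_derive_primitive.
  - intros y _; apply continuity_pt_filterlim, (cont_primitive f 0 Cf).
  - rewrite Rmin_left, Rmax_right in Hc by lra.
    rewrite !H in Ec by lra.
    assert (Z : f c = 0).
    { apply (Rmult_eq_reg_r (q - p)); lra. }
    specialize (B c); simpl in B.
    assert (Bc : ball x r c).
    { change (Rabs (c - x) < r); apply Rabs_def1; lra. }
    specialize (B Bc); change (Rabs (f c - f x) < Rabs (f x)) in B.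
    rewrite Z, Rminus_0_l, Rabs_Ropp in B; lra.
Qed.


Lemma RInt_sum (f : nat -> R -> R) n a b : (forall i, cont (f i)) ->
  RInt (fun x => sum_f_R0 (fun i => f i x) n) a b
  = sum_f_R0 (fun i => RInt (f i) a b) n.
Proof.
  intros Cf.
  assert (Cs : forall m, cont (fun x => sum_f_R0 (fun i => f i x) m)).
  { induction m as [| m IH]; cbn [sum_f_R0]; [apply Cf |].
    apply cont_plus; [exact IH | apply Cf]. }
  induction n as [| n IH]; cbn [sum_f_R0]; [reflexivity |].
  rewrite RInt_plusR, IH by auto; reflexivity.
Qed.


(** * Rotation invariance of the sphere integral *)

(** The integral over the unit sphere in the coordinates colatitude [b] and
    azimuth [t]. *)
Definition sphere_int (f : R -> R -> R) : R :=
  RInt (fun b => RInt (fun t => sin b * f b t) 0 (2 * PI)) 0 PI.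

Lemma sphere_int_ext (f g : R -> R -> R) :
  (forall b t, f b t = g b t) -> sphere_int f = sphere_int g.
Proof.
  intros H; apply RInt_extR; intros b; apply RInt_extR; intros t.
  now rewrite H.
Qed.

(** If [h g] is transported by the rotations about the [x2]-axis by the angle
    [g], then [sin b] times its derivative in [g] is a divergence in [(b, t)]
    whose flux vanishes on the boundary of the coordinate rectangle, because
    [sin] vanishes at [0], [PI] and [2 * PI]. *)
Lemma sphere_int_flow (h hg hb ht : R -> R -> R -> R) (g0 g1 : R) :
  cont (fun p : R * R * R => h (fst (fst p)) (snd (fst p)) (snd p)) ->
  cont (fun p : R * R * R => hg (fst (fst p)) (snd (fst p)) (snd p)) ->
  cont (fun p : R * R * R => hb (fst (fst p)) (snd (fst p)) (snd p)) ->
  cont (fun p : R * R * R => ht (fst (fst p)) (snd (fst p)) (snd p)) ->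
  (forall g b t, is_derive (fun g => h g b t) g (hg g b t)) ->
  (forall g b t, is_derive (fun b => h g b t) b (hb g b t)) ->
  (forall g b t, is_derive (fun t => h g b t) t (ht g b t)) ->
  (forall g b t, sin b * hg g b t
     = cos b * sin t * ht g b t - sin b * cos t * hb g b t) ->
  sphere_int (h g1) = sphere_int (h g0).
Proof.
  intros Ch Chg Chb Cht Dg Db Dt E; unfold sphere_int.
  apply Rminus_diag_uniq.
  rewrite <- RInt_minusR by cont.
  transitivity (RInt (fun b => RInt (fun t =>
    RInt (fun g => sin b * hg g b t) g0 g1) 0 (2 * PI)) 0 PI).
  { apply RInt_extR; intros b; rewrite <- RInt_minusR by cont.
    apply RInt_extR; intros t; rewrite RInt_scalR by cont.
    rewrite (RInt_FTC (fun g => h g b t) (fun g => hg g b t) g0 g1)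
      by (cont; intros; apply Dg); ring. }
  transitivity (RInt (fun b => RInt (fun g => RInt (fun t =>
    sin b * hg g b t) 0 (2 * PI)) g0 g1) 0 PI).
  { apply RInt_extR; intros b; apply (RInt_fubini (fun t g => _)); cont. }
  rewrite (RInt_fubini (fun b g => RInt (fun t => sin b * hg g b t) 0 (2 * PI)))
    by cont.
  apply RInt_zero; intros g _.
  (* The integrand is a divergence:
     [d_t (cos b sin t h) - d_b (sin b cos t h)]. *)
  transitivity (RInt (fun b => RInt (fun t =>
    cos b * (cos t * h g b t + sin t * ht g b t)
    - cos t * (cos b * h g b t + sin b * hb g b t)) 0 (2 * PI)) 0 PI).
  { apply RInt_extR; intros b; apply RInt_extR; intros t; rewrite E; ring. }
  transitivity
   (RInt (fun b => RInt (fun t =>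
      cos b * (cos t * h g b t + sin t * ht g b t)) 0 (2 * PI)) 0 PI
    - RInt (fun b => RInt (fun t =>
      cos t * (cos b * h g b t + sin b * hb g b t)) 0 (2 * PI)) 0 PI).
  { rewrite <- RInt_minusR by cont; apply RInt_extR; intros b.
    apply RInt_minusR; cont. }
  replace (RInt (fun b => RInt (fun t =>
      cos b * (cos t * h g b t + sin t * ht g b t)) 0 (2 * PI)) 0 PI) with 0.
  2: { symmetry; apply RInt_zero; intros b _; rewrite RInt_scalR by cont.
    rewrite (RInt_FTC (fun t => sin t * h g b t)); [| | cont].
    - rewrite sin_2PI, sin_0; ring.
    - intros t; apply (is_derive_mult sin (fun t => h g b t));
        [apply is_derive_sin | apply Dt | intros; apply Rmult_comm]. }
  rewrite (RInt_fubini (fun b t =>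
      cos t * (cos b * h g b t + sin b * hb g b t))) by cont.
  rewrite RInt_zero; [ring |]; intros t _; rewrite RInt_scalR by cont.
  rewrite (RInt_FTC (fun b => sin b * h g b t)); [| | cont].
  - rewrite sin_PI, sin_0; ring.
  - intros b; apply (is_derive_mult sin (fun b => h g b t));
      [apply is_derive_sin | apply Db | intros; apply Rmult_comm].
Qed.

(** The scalar product of the point of colatitude [b] and azimuth [t] with the
    unit vector [(sin g, 0, cos g)]. *)
Definition height (g b t : R) : R := cos b * cos g + sin b * cos t * sin g.

(** Invariance of the sphere integral under rotations about the [x2]-axis, for
    products of two zonal functions whose axes lie at a fixed angle [c]. *)
Lemma sphere_int_rotate_C1 (P dP F dF : R -> R) (c g0 g1 : R) :
  cont dP -> cont dF ->
  (forall x, is_derive P x (dP x)) -> (forall x, is_derive F x (dF x)) ->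
  sphere_int (fun b t => P (height g1 b t) * F (height (g1 + c) b t))
  = sphere_int (fun b t => P (height g0 b t) * F (height (g0 + c) b t)).
Proof.
  intros CdP CdF DP DF.
  assert (CP : cont P).
  { intros x; apply (ex_derive_continuous (V := R_NormedModule)).
    exists (dP x); apply DP. }
  assert (CF : cont F).
  { intros x; apply (ex_derive_continuous (V := R_NormedModule)).
    exists (dF x); apply DF. }
  assert (Chain : forall u v : R -> R, forall x du dv,
    is_derive u x du -> is_derive v x dv ->
    is_derive (fun y => P (u y) * F (v y)) x
      (dP (u x) * du * F (v x) + P (u x) * (dF (v x) * dv))).
  { intros u v x du dv Hu Hv.
    apply (is_derive_mult (fun y => P (u y)) (fun y => F (v y)));
      [| | intros; apply Rmult_comm].
    - rewrite Rmult_comm; apply (is_derive_comp P u); auto.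
    - rewrite Rmult_comm; apply (is_derive_comp F v); auto. }
  set (A := height).
  set (Ag := fun g b t => - cos b * sin g + sin b * cos t * cos g).
  set (Ab := fun g b t => - sin b * cos g + cos b * cos t * sin g).
  set (At := fun g b t => - sin b * sin t * sin g).
  set (D := fun (dA : R -> R -> R -> R) (g b t : R) =>
    dP (A g b t) * dA g b t * F (A (g + c) b t)
    + P (A g b t) * (dF (A (g + c) b t) * dA (g + c) b t)).
  apply (sphere_int_flow
    (fun g b t => P (A g b t) * F (A (g + c) b t)) (D Ag) (D Ab) (D At)).
  1-4: unfold D, A, Ag, Ab, At, height; cont.
  all: intros g b t.
  - apply (Chain (fun g => A g b t) (fun g => A (g + c) b t));
      unfold A, Ag, height; auto_derive; trivial; ring.
  - apply (Chain (fun b => A g b t) (fun b => A (g + c) b t));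
      unfold A, Ab, height; auto_derive; trivial; ring.
  - apply (Chain (fun t => A g b t) (fun t => A (g + c) b t));
      unfold A, At, height; auto_derive; trivial; ring.
  - assert (K : forall g, sin b * Ag g b t
      = cos b * sin t * At g b t - sin b * cos t * Ab g b t).
    { intros x; unfold Ag, Ab, At.
      replace (sin b * (- cos b * sin x + sin b * cos t * cos x)) with
        (- sin b * cos b * sin x * 1 + sin b * sin b * cos t * cos x) by ring.
      rewrite <- (sin2_cos2 t); unfold Rsqr; ring. }
    unfold D.
    transitivity (dP (A g b t) * (sin b * Ag g b t) * F (A (g + c) b t)
      + P (A g b t) * (dF (A (g + c) b t) * (sin b * Ag (g + c) b t)));
      [ring |].
    rewrite !K; ring.
Qed.

(** The means [x |-> int_0^1 F (x + h * s) ds] of [F] are of class [C^1] for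
    [h <> 0], so the invariance holds for them; both sides are continuous in
    [h], so it persists at [h = 0], where the mean is [F] itself. *)
Lemma sphere_int_rotate (P dP F : R -> R) (c g0 g1 : R) :
  cont dP -> (forall x, is_derive P x (dP x)) -> cont F ->
  sphere_int (fun b t => P (height g1 b t) * F (height (g1 + c) b t))
  = sphere_int (fun b t => P (height g0 b t) * F (height (g0 + c) b t)).
Proof.
  intros CdP DP CF.
  assert (CP : cont P).
  { intros x; apply (ex_derive_continuous (V := R_NormedModule)).
    exists (dP x); apply DP. }
  set (M := fun h x => RInt (fun s => F (x + h * s)) 0 1).
  assert (CM : cont (fun p : R * R => M (fst p) (snd p))) by (unfold M; cont).
  assert (M0 : forall x, M 0 x = F x).
  { intros x; unfold M; rewrite (RInt_extR _ (fun _ => F x)).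
    - rewrite RInt_const; change ((1 - 0) * F x = F x); ring.
    - intros s; f_equal; ring. }
  set (G := fun h =>
    sphere_int (fun b t => P (height g1 b t) * M h (height (g1 + c) b t))
    - sphere_int (fun b t => P (height g0 b t) * M h (height (g0 + c) b t))).
  assert (CG : cont G) by (unfold G, sphere_int, height; cont).
  assert (G1 : forall h, h <> 0 -> G h = 0).
  { intros h Hh; apply Rminus_diag_eq.
    apply sphere_int_rotate_C1 with dP (fun x => (F (x + h) - F x) / h); auto.
    - unfold Rdiv; cont.
    - intros x.
      apply is_derive_ext with (fun x => (RInt F 0 (x + h) - RInt F 0 x) / h).
      + intros y; unfold M.
        replace (RInt (fun s => F (y + h * s)) 0 1)
          with (/ h * (h * RInt (fun s => F (y + h * s)) 0 1)) by (field; auto).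
        rewrite (RInt_extR (fun s => F (y + h * s)) (fun s => F (h * s + y)))
          by (intros; now rewrite (Rplus_comm y)).
        rewrite RInt_affine by exact CF.
        rewrite Rmult_0_r, Rmult_1_r, Rplus_0_l, (Rplus_comm h).
        rewrite (RInt_chaslesR F 0 y (y + h)) by exact CF.
        set (I := RInt F 0 y); set (K := RInt F y (y + h)).
        change ((I + K - I) / h = / h * K); field; auto.
      + unfold Rdiv; rewrite Rmult_comm.
        apply is_derive_ext with
          (fun x => / h * (RInt F 0 (x + h) - RInt F 0 x)).
        { intros; apply Rmult_comm. }
        apply (is_derive_scal (fun x => RInt F 0 (x + h) - RInt F 0 x)).
        apply (is_derive_minus (fun x => RInt F 0 (x + h))
          (fun x => RInt F 0 x)).
        * replace (F (x + h)) with (scal 1 (F (x + h))) by apply Rmult_1_l.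
          apply (is_derive_comp (fun y => RInt F 0 y) (fun x => x + h)).
          now apply is_derive_primitive.
          auto_derive; trivial; ring.
        * now apply is_derive_primitive. }
  assert (G0 : G 0 = 0).
  { destruct (Req_dec (G 0) 0) as [E | N]; [exact E | exfalso].
    assert (e0 : 0 < Rabs (G 0)) by now apply Rabs_pos_lt.
    pose proof (proj1 (filterlim_locally _ _) (CG 0) (mkposreal _ e0))
      as [d Hd].
    specialize (Hd (d / 2)).
    rewrite (G1 (d / 2)) in Hd by (destruct d; simpl; lra).
    assert (B : ball (0 : R) d (d / 2)).
    { change (Rabs (d / 2 - 0) < d); destruct d as [d p]; simpl.
      rewrite Rabs_pos_eq; lra. }
    specialize (Hd B); change (Rabs (0 - G 0) < Rabs (G 0)) in Hd.
    rewrite Rminus_0_l, Rabs_Ropp in Hd; lra. }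
  apply Rminus_diag_uniq; rewrite <- G0; unfold G; apply f_equal2;
    apply sphere_int_ext; intros; now rewrite M0.
Qed.

(** The factor [cos b * cos f - sin b * sin f * cos t] is the height over a pole
    at angle [f] from the north pole; the rotation that brings this pole to the
    north, followed by the half turn [t + PI], exchanges the two factors. In
    other words, averaging zonal functions over circles of angular radius [f] is
    a symmetric operator. *)
Lemma sphere_int_symm (P dP F : R -> R) (f : R) :
  cont dP -> (forall x, is_derive P x (dP x)) -> cont F ->
  sphere_int (fun b t => P (cos b) * F (cos b * cos f - sin b * sin f * cos t))
  = sphere_int (fun b t =>
      P (cos b * cos f - sin b * sin f * cos t) * F (cos b)).
Proof.
  intros CdP DP CF.
  assert (CP : cont P).
  { intros x; apply (ex_derive_continuous (V := R_NormedModule)).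
    exists (dP x); apply DP. }
  transitivity (sphere_int (fun b t =>
    P (height f b t) * F (height (f + - f) b t))).
  - rewrite (sphere_int_rotate P dP F (- f) 0 f) by assumption.
    apply sphere_int_ext; intros b t; unfold height.
    rewrite Rplus_0_l, sin_0, cos_0, sin_neg, cos_neg; do 2 f_equal; ring.
  - apply RInt_extR; intros b.
    rewrite <- (RInt_period _ (2 * PI) PI).
    + apply RInt_extR; intros t; unfold height.
      rewrite neg_cos, Rplus_opp_r, sin_0, cos_0; do 3 f_equal; ring.
    + unfold height; cont.
    + intros t; unfold height; now rewrite cos_plus, cos_2PI, sin_2PI,
        Rmult_1_r, Rmult_0_r, Rminus_0_r.
Qed.

(** * Rotations and Euler angles *)

Definition dot (x y : R3) : R :=
  let '(x1, x2, x3) := x in let '(y1, y2, y3) := y in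
  x1 * y1 + x2 * y2 + x3 * y3.

Definition cross (x y : R3) : R3 :=
  let '(x1, x2, x3) := x in let '(y1, y2, y3) := y in
  (x2 * y3 - x3 * y2, x3 * y1 - x1 * y3, x1 * y2 - x2 * y1).

Definition lin_comb (a : R) (x : R3) (b : R) (y : R3) : R3 :=
  let '(x1, x2, x3) := x in let '(y1, y2, y3) := y in
  (a * x1 + b * y1, a * x2 + b * y2, a * x3 + b * y3).

Lemma cos2_sin2 t : cos t * cos t + sin t * sin t = 1.
Proof. rewrite <- (sin2_cos2 t); unfold Rsqr; ring. Qed.

Ltac triple := apply f_equal2; [apply f_equal2 |].

Ltac nsatz_trig t :=
  pose proof (cos2_sin2 t) as Htrig; revert Htrig;
  generalize (cos t), (sin t); intros; nsatz.

Lemma rotU_dot a x y : dot (rotU a x) (rotU a y) = dot x y.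
Proof.
  destruct x as [[x1 x2] x3], y as [[y1 y2] y3]; simpl.
  nsatz_trig a.
Qed.

Lemma rotV_dot b x y : dot (rotV b x) (rotV b y) = dot x y.
Proof.
  destruct x as [[x1 x2] x3], y as [[y1 y2] y3]; simpl.
  nsatz_trig b.
Qed.

Lemma rot_dot a b x y : dot (rot a b x) (rot a b y) = dot x y.
Proof. unfold rot; now rewrite rotU_dot, rotV_dot. Qed.

Lemma rotU_cross a x y : cross (rotU a x) (rotU a y) = rotU a (cross x y).
Proof.
  destruct x as [[x1 x2] x3], y as [[y1 y2] y3]; simpl.
  triple; nsatz_trig a.
Qed.

Lemma rotV_cross b x y : cross (rotV b x) (rotV b y) = rotV b (cross x y).
Proof.
  destruct x as [[x1 x2] x3], y as [[y1 y2] y3]; simpl.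
  triple; nsatz_trig b.
Qed.

Lemma rot_cross a b x y : cross (rot a b x) (rot a b y) = rot a b (cross x y).
Proof. unfold rot; now rewrite rotU_cross, rotV_cross. Qed.

Lemma rot_lin a b k x l y :
  rot a b (lin_comb k x l y) = lin_comb k (rot a b x) l (rot a b y).
Proof.
  destruct x as [[x1 x2] x3], y as [[y1 y2] y3]; unfold rot; simpl.
  triple; ring.
Qed.

Lemma cross_lin z k x l y :
  cross z (lin_comb k x l y) = lin_comb k (cross z x) l (cross z y).
Proof.
  destruct x as [[x1 x2] x3], y as [[y1 y2] y3], z as [[z1 z2] z3]; simpl.
  triple; ring.
Qed.

Lemma circle_param a b : a * a + b * b = 1 ->
  exists t, 0 <= t <= 2 * PI /\ a = cos t /\ b = sin t.
Proof.
  intros H.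
  assert (Ha : -1 <= a <= 1) by nra.
  assert (Hs : sin (acos a) = Rabs b).
  { rewrite sin_acos by exact Ha; rewrite <- sqrt_Rsqr_abs; f_equal.
    unfold Rsqr; nra. }
  pose proof (acos_bound a) as Hb.
  destruct (Rle_dec 0 b) as [L | L].
  - exists (acos a); rewrite cos_acos by exact Ha; rewrite Hs.
    rewrite Rabs_pos_eq by exact L; repeat split; lra.
  - exists (2 * PI - acos a).
    rewrite cos_minus, sin_minus, cos_2PI, sin_2PI, cos_acos by exact Ha.
    rewrite Hs, Rabs_left by lra; repeat split; lra.
Qed.

Lemma sphere_param z : dot z z = 1 ->
  exists a b, 0 <= a <= 2 * PI /\ 0 <= b <= PI /\ z = rot a b (0, 0, 1).
Proof.
  destruct z as [[z1 z2] z3]; simpl; intros H.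
  assert (H3 : -1 <= z3 <= 1) by nra.
  assert (Hc : cos (acos z3) = z3) by now apply cos_acos.
  pose proof (cos2_sin2 (acos z3)) as Hs; rewrite Hc in Hs.
  assert (P : exists a, 0 <= a <= 2 * PI /\
    z1 = sin (acos z3) * cos a /\ z2 = sin (acos z3) * sin a).
  { set (s := sin (acos z3)) in *.
    destruct (Req_dec s 0) as [E | N].
    - exists 0; pose proof PI_RGT_0; rewrite E in *; repeat split; try lra; nra.
    - destruct (circle_param (z1 / s) (z2 / s)) as (a & Ha & E1 & E2).
      + replace (z1 / s * (z1 / s) + z2 / s * (z2 / s))
          with ((z1 * z1 + z2 * z2) / (s * s))
          by (field; exact N).
        replace (z1 * z1 + z2 * z2) with (s * s) by lra.
        field; exact N.
      + exists a; rewrite <- E1, <- E2; repeat split; try lra; field; exact N. }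
  destruct P as (a & Ha & E1 & E2); exists a, (acos z3).
  rewrite rot_north_pole, <- E1, <- E2, Hc; pose proof (acos_bound z3); auto.
Qed.

(** Euler angles: a rotation is determined by the images of two axes. The
    angles [a], [b] are those of the image of the north pole; what remains is a
    rotation that fixes the pole. *)
Lemma rot_rot a1 b1 a2 b2 : exists a b t,
  0 <= a <= 2 * PI /\ 0 <= b <= PI /\
  forall x, rot a1 b1 (rot a2 b2 x) = rot a b (rotU t x).
Proof.
  set (M := fun x => rot a1 b1 (rot a2 b2 x)).
  assert (Mdot : forall x y, dot (M x) (M y) = dot x y).
  { intros; unfold M; now rewrite !rot_dot. }
  assert (Mcross : forall x y, cross (M x) (M y) = M (cross x y)).
  { intros; unfold M; now rewrite !rot_cross. }
  assert (Mlin : forall k x l y,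
    M (lin_comb k x l y) = lin_comb k (M x) l (M y)).
  { intros; unfold M; now rewrite !rot_lin. }
  destruct (sphere_param (M (0, 0, 1))) as (a & b & Ha & Hb & Ez).
  { rewrite Mdot; simpl; ring. }
  set (u := rot a b (1, 0, 0)); set (v := rot a b (0, 1, 0)).
  set (z := rot a b (0, 0, 1)) in *.
  set (c := dot (M (1, 0, 0)) u); set (s := dot (M (1, 0, 0)) v).
  (* Expansion in the orthonormal frame [u], [v], [z]. *)
  assert (Exp : forall p, dot p z = 0 -> p = lin_comb (dot p u) u (dot p v) v).
  { intros [[p1 p2] p3]; unfold u, v, z, rot; simpl.
    pose proof (cos2_sin2 a) as Ka; pose proof (cos2_sin2 b) as Kb.
    set (ca := cos a) in *; set (sa := sin a) in *.
    set (cb := cos b) in *; set (sb := sin b) in *; clearbody ca sa cb sb.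
    intros Z; triple; nsatz. }
  assert (E1 : M (1, 0, 0) = lin_comb c u s v).
  { apply Exp; rewrite <- Ez, Mdot; simpl; ring. }
  assert (Zu : cross z u = v).
  { unfold z, u, v; rewrite rot_cross; f_equal; simpl; triple; ring. }
  assert (Zv : cross z v = lin_comb (-1) u 0 u).
  { unfold z, u, v; rewrite rot_cross, <- rot_lin; f_equal; simpl;
      triple; ring. }
  assert (E2 : M (0, 1, 0) = lin_comb c v (- s) u).
  { replace (0, 1, 0) with (cross (0, 0, 1) (1, 0, 0))
      by (simpl; triple; ring).
    rewrite <- Mcross, Ez, E1, cross_lin, Zu, Zv.
    destruct u as [[u1 u2] u3], v as [[v1 v2] v3]; simpl; triple; ring. }
  assert (Ecs : c * c + s * s = 1).
  { assert (K : dot (M (1, 0, 0)) (M (1, 0, 0)) = 1)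
      by (rewrite Mdot; simpl; ring).
    rewrite E1 in K.
    assert (Ku : dot u u = 1) by (unfold u; rewrite rot_dot; simpl; ring).
    assert (Kv : dot v v = 1) by (unfold v; rewrite rot_dot; simpl; ring).
    assert (Kuv : dot u v = 0) by (unfold u, v; rewrite rot_dot; simpl; ring).
    clearbody u v c s; clear - K Ku Kv Kuv.
    destruct u as [[u1 u2] u3], v as [[v1 v2] v3]; simpl in *; nsatz. }
  destruct (circle_param c s Ecs) as (t & _ & Ec & Es).
  exists a, b, t; split; [exact Ha | split; [exact Hb |]].
  intros x; change (M x = rot a b (rotU t x)).
  destruct x as [[x1 x2] x3].
  replace (x1, x2, x3)
    with (lin_comb 1 (lin_comb x1 (1, 0, 0) x2 (0, 1, 0)) x3 (0, 0, 1))
    by (simpl; triple; ring).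
  rewrite !Mlin, E1, E2, Ez.
  replace (rotU t (lin_comb 1 (lin_comb x1 (1, 0, 0) x2 (0, 1, 0)) x3 (0, 0, 1)))
    with (lin_comb 1 (lin_comb x1 (lin_comb c (1, 0, 0) s (0, 1, 0))
      x2 (lin_comb c (0, 1, 0) (- s) (1, 0, 0))) x3 (0, 0, 1))
    by (rewrite Ec, Es; simpl; triple; ring).
  now rewrite !rot_lin.
Qed.

(** * An Abel-type Volterra equation *)

(** The function [exp (- C r) * int_0^r |f|] is nonincreasing and starts at
    [0]. *)
Lemma gronwall (f : R -> R) (C d : R) : cont f -> 0 <= C ->
  (forall r, 0 <= r <= d -> Rabs (f r) <= C * RInt (fun y => Rabs (f y)) 0 r) ->
  forall r, 0 <= r <= d -> f r = 0.
Proof.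
  intros Cf HC H r Hr.
  set (I := fun r => RInt (fun y => Rabs (f y)) 0 r) in *.
  assert (CI : cont I) by (apply cont_primitive; cont).
  assert (Ce : cont (fun x => exp (- C * x))).
  { apply (cont_comp exp); [intros x; apply continuous_exp | cont]. }
  assert (DI : forall x, is_derive I x (Rabs (f x))).
  { intros; apply (is_derive_primitive (fun y => Rabs (f y))); cont. }
  assert (E : RInt (fun x => (Rabs (f x) - C * I x) * exp (- C * x)) 0 r
    = I r * exp (- C * r) - I 0 * exp (- C * 0)).
  { apply (RInt_FTC (fun x => I x * exp (- C * x))); [| cont].
    intros x; replace ((Rabs (f x) - C * I x) * exp (- C * x)) with
      (Rabs (f x) * exp (- C * x) + I x * (- C * exp (- C * x))) by ring.
    apply (is_derive_mult I (fun x => exp (- C * x))); [apply DI | |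
      intros; apply Rmult_comm].
    auto_derive; trivial; ring. }
  assert (I0 : I 0 = 0) by apply (RInt_point (V := R_CompleteNormedModule)).
  assert (L : RInt (fun x => (Rabs (f x) - C * I x) * exp (- C * x)) 0 r <= 0).
  { apply Rle_trans with (RInt (fun _ => 0) 0 r);
      [| right; now apply RInt_zero].
    apply RInt_le; [lra | apply ex_RInt_cont; cont |
        apply ex_RInt_cont; cont |].
    intros x Hx; pose proof (exp_pos (- C * x)); specialize (H x).
    unfold I in *; nra. }
  rewrite E, I0 in L; pose proof (exp_pos (- C * r)).
  assert (I r <= 0) by nra.
  specialize (H r Hr); fold (I r) in H.
  pose proof (Rabs_pos (f r)).
  destruct (Req_dec (f r) 0) as [Z | Z]; [exact Z |].
  apply Rabs_pos_lt in Z; nra.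
Qed.

Section Volterra.
Context (nu : R -> R) (s1 d : R).
Context (Cnu : cont nu) (s1_pos : 0 < s1) (d_pos : 0 < d)
  (nu0 : forall s, s <= s1 -> nu s = 0).

Definition angular_int (h : R -> R) (r : R) : R :=
  RInt (fun p => h p * nu (r * sin p)) 0 PI.

(** The Abel transform of [nu], up to the substitution [s = r * sin p]. *)
Let E0 : R -> R := angular_int (fun _ => 1).

(** Remainder terms: those controlled by the integral of the leading term [E0],
    which Gronwall's inequality absorbs. *)
Definition negligible (u : R -> R) : Prop :=
  exists C, 0 <= C /\ forall r, 0 <= r <= d ->
    Rabs (u r) <= C * RInt (fun y => Rabs (E0 y)) 0 r.

Lemma cont_angular_int (h : R -> R) : cont h -> cont (angular_int h).
Proof. intros Ch; unfold angular_int; cont. Qed.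

Lemma angular_int_minus (g h : R -> R) r : cont g -> cont h ->
  angular_int (fun p => g p - h p) r = angular_int g r - angular_int h r.
Proof.
  intros Cg Ch; unfold angular_int; rewrite <- RInt_minusR by cont.
  apply RInt_extR; intros; ring.
Qed.

Lemma angular_int_ext g h r :
  (forall p, g p = h p) -> angular_int g r = angular_int h r.
Proof. intros H; apply RInt_extR; intros; now rewrite H. Qed.

Lemma angular_int_zero h r : 0 <= r <= s1 -> angular_int h r = 0.
Proof.
  intros Hr; apply RInt_zero; intros p _; rewrite nu0; [ring |].
  pose proof (SIN_bound p); nra.
Qed.

Lemma negligible_ext u v :
  (forall r, u r = v r) -> negligible u -> negligible v.
Proof.
  intros E (C & HC & H); exists C; split; [exact HC |].
  intros r Hr; rewrite <- E; auto.
Qed.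

Lemma negligible_plus u v :
  negligible u -> negligible v -> negligible (fun r => u r + v r).
Proof.
  intros (C & HC & H) (D & HD & K); exists (C + D); split; [lra |].
  intros r Hr; eapply Rle_trans; [apply Rabs_triang |].
  specialize (H r Hr); specialize (K r Hr); lra.
Qed.

Lemma negligible_scal k u : negligible u -> negligible (fun r => k * u r).
Proof.
  intros (C & HC & H); exists (Rabs k * C); pose proof (Rabs_pos k).
  split; [nra |]; intros r Hr; rewrite Rabs_mult, Rmult_assoc.
  apply Rmult_le_compat_l; auto.
Qed.

Lemma negligible_minus u v :
  negligible u -> negligible v -> negligible (fun r => u r - v r).
Proof.
  intros Hu Hv; apply negligible_ext with (fun r => u r + -1 * v r);
    [intros; ring |].
  apply negligible_plus; [exact Hu | now apply negligible_scal].
Qed.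

Lemma negligible_zero : negligible (fun _ => 0).
Proof.
  exists 0; split; [lra |]; intros; rewrite Rabs_R0; lra.
Qed.

(** Averaging over [r * v], [0 <= v <= 1], is the same as integrating over
    [[0, r]] and dividing by [r]. The division is harmless because [u] vanishes
    up to [s1]. *)
Lemma negligible_mean (u : R -> R) k :
  cont u -> (forall r, 0 <= r <= s1 -> u r = 0) ->
  negligible (fun r => u r - E0 r) ->
  negligible (fun r => RInt (fun v => v ^ k * u (r * v)) 0 1).
Proof.
  intros Cu u0 (C & HC & H).
  assert (CE : cont E0) by (apply cont_angular_int; cont).
  set (I := fun r => RInt (fun y => Rabs (E0 y)) 0 r) in *.
  exists ((1 + C * d) / s1); split.
  { apply Rmult_le_pos; [nra | left; now apply Rinv_0_lt_compat]. }
  intros r Hr.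
  assert (Ipos : forall x, 0 <= x -> 0 <= I x).
  { intros x Hx; apply RInt_ge_0; [exact Hx | apply ex_RInt_cont; cont |].
    intros; apply Rabs_pos. }
  assert (Imon : forall x, 0 <= x <= r -> I x <= I r).
  { intros x Hx; unfold I; rewrite (RInt_chaslesR _ 0 x r) by cont.
    enough (0 <= RInt (fun y => Rabs (E0 y)) x r) by lra.
    apply RInt_ge_0; [lra | apply ex_RInt_cont; cont |].
    intros; apply Rabs_pos. }
  destruct (Rle_dec r s1) as [L | L].
  { rewrite RInt_zero.
    - rewrite Rabs_R0; apply Rmult_le_pos; [| now apply Ipos].
      apply Rmult_le_pos; [nra | left; now apply Rinv_0_lt_compat].
    - rewrite Rmin_left, Rmax_right by lra; intros v Hv.
      rewrite u0; [ring |]; nra. }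
  assert (A1 : Rabs (RInt (fun v => v ^ k * u (r * v)) 0 1)
    <= RInt (fun v => Rabs (u (r * v))) 0 1).
  { eapply Rle_trans.
    { apply abs_RInt_le; [lra | apply ex_RInt_cont; cont]. }
    apply RInt_le; [lra | apply ex_RInt_cont; cont |
        apply ex_RInt_cont; cont |].
    intros v Hv; rewrite Rabs_mult.
    assert (0 <= v ^ k <= 1).
    { split; [apply pow_le; lra |]; rewrite <- (pow1 k); apply pow_incr; lra. }
    rewrite (Rabs_pos_eq (v ^ k)) by lra.
    pose proof (Rabs_pos (u (r * v))); nra. }
  assert (A2 : r * RInt (fun v => Rabs (u (r * v))) 0 1
    = RInt (fun y => Rabs (u y)) 0 r).
  { pose proof (RInt_affine (fun y => Rabs (u y)) r 0 0 1) as K.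
    rewrite Rmult_0_r, Rmult_1_r, !Rplus_0_r in K; rewrite <- K by cont.
    f_equal; apply RInt_extR; intros; now rewrite Rplus_0_r. }
  assert (A3 : RInt (fun y => Rabs (u y)) 0 r <= (1 + C * d) * I r).
  { apply Rle_trans with (RInt (fun y => Rabs (E0 y) + C * I r) 0 r).
    - apply RInt_le; [lra | apply ex_RInt_cont; cont |
        apply ex_RInt_cont; cont |].
      intros y Hy.
      assert (K : Rabs (u y - E0 y) <= C * I y) by (apply H; lra).
      assert (I y <= I r) by (apply Imon; lra).
      pose proof (Rabs_triang (u y - E0 y) (E0 y)) as T.
      replace (u y - E0 y + E0 y) with (u y) in T by ring; nra.
    - rewrite RInt_plusR by cont; rewrite RInt_const.
      change (I r + (r - 0) * (C * I r) <= (1 + C * d) * I r).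
      assert (0 <= C * I r) by (apply Rmult_le_pos, Ipos; lra).
      nra. }
  eapply Rle_trans; [exact A1 |].
  set (J := RInt (fun v => Rabs (u (r * v))) 0 1) in *.
  assert (HJ : 0 <= J).
  { apply RInt_ge_0; [lra | apply ex_RInt_cont; unfold J; cont |].
    intros; apply Rabs_pos. }
  apply (Rmult_le_reg_l s1); [exact s1_pos |].
  replace (s1 * ((1 + C * d) / s1 * RInt (fun y => Rabs (E0 y)) 0 r))
    with ((1 + C * d) * I r) by (unfold I; field; lra).
  nra.
Qed.

(** An extra factor [cos p ^ 2], which vanishes at the singular angle [PI / 2],
    smooths: it replaces the angular integral by its means over smaller
    radii. The identity is integration by parts against [- cos p / sin p],
    whose derivative is [1 / sin p ^ 2]. The singularities at [0] and [PI] do no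
    harm because [nu] vanishes near [0]. *)
Lemma angular_int_cos2 j r : 0 <= r ->
  angular_int (fun p => cos p ^ 2 * sin p ^ (2 * j)) r
  = RInt (fun v =>
      v ^ (2 * j + 1) * angular_int (fun p => sin p ^ (2 * j)) (r * v)) 0 1.
Proof.
  intros Hr.
  (* The right-hand side after exchanging the integrals, as a function of
     [x = sin p]. *)
  set (Z := fun x => RInt (fun v =>
    v ^ (2 * j + 1) * (x ^ (2 * j) * nu (r * v * x))) 0 1).
  assert (CZ : cont Z) by (unfold Z; cont).
  assert (EZ : RInt (fun v => v ^ (2 * j + 1)
      * angular_int (fun p => sin p ^ (2 * j)) (r * v)) 0 1
    = RInt (fun p => Z (sin p)) 0 PI :> R).
  { unfold Z; rewrite <- (RInt_fubini (fun v p =>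
      v ^ (2 * j + 1) * (sin p ^ (2 * j) * nu (r * v * sin p)))) by cont.
    apply RInt_extR; intros v; unfold angular_int; symmetry.
    apply RInt_scalR; cont. }
  rewrite EZ; clear EZ.
  set (N := fun x => RInt (fun y => y ^ (2 * j + 1) * nu (r * y)) 0 x).
  assert (EN : forall x, N x = x * x * Z x).
  { intros x.
    pose proof (RInt_affine (fun y => y ^ (2 * j + 1) * nu (r * y)) x 0 0 1) as K.
    rewrite Rmult_0_r, Rmult_1_r, !Rplus_0_r in K; unfold N.
    rewrite <- K by cont.
    rewrite Rmult_assoc; f_equal; unfold Z; rewrite <- RInt_scalR by cont.
    apply RInt_extR; intros v; rewrite Rplus_0_r.
    rewrite !pow_add, Rpow_mult_distr, !pow_1.
    replace (r * (x * v)) with (r * v * x) by ring; ring. }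
  assert (DN : forall x, is_derive N x (x ^ (2 * j + 1) * nu (r * x))).
  { intros x; apply (is_derive_primitive
      (fun y => y ^ (2 * j + 1) * nu (r * y))); cont. }
  assert (Z0 : forall x, r * x < s1 -> Z x = 0).
  { intros x Hx; apply RInt_zero; rewrite Rmin_left, Rmax_right by lra.
    intros v Hv; rewrite nu0; [ring |].
    destruct (Rle_dec 0 (r * x)); nra. }
  assert (K : RInt (fun p => Z (sin p)
      - cos p ^ 2 * sin p ^ (2 * j) * nu (r * sin p)) 0 PI
    = - (cos PI * sin PI * Z (sin PI)) - - (cos 0 * sin 0 * Z (sin 0))).
  { apply (RInt_FTC (fun p => - (cos p * sin p * Z (sin p)))); [| cont].
    intros p; destruct (Rlt_dec 0 (sin p)) as [P | P].
    - apply is_derive_ext_loc with (fun p => - (cos p / sin p * N (sin p))).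
      + assert (L : locally p (fun q => 0 < sin q)).
        { apply (continuous_sin p), (open_gt 0), P. }
        revert L; apply filter_imp; intros q Hq; eqR; rewrite EN; field; lra.
      + replace (Z (sin p) - cos p ^ 2 * sin p ^ (2 * j) * nu (r * sin p)) with
          (- (- / sin p ^ 2 * N (sin p) + cos p / sin p *
            (cos p * (sin p ^ (2 * j + 1) * nu (r * sin p))))).
        2: { rewrite EN, pow_add, pow_1; field; lra. }
        apply (is_derive_opp (fun p => cos p / sin p * N (sin p))).
        apply (is_derive_mult (fun p => cos p / sin p) (fun p => N (sin p)));
          [| | intros; apply Rmult_comm].
        * auto_derive; [lra |].
          replace (- / sin p ^ 2)
            with (- ((Rsqr (sin p) + Rsqr (cos p)) / sin p ^ 2))
            by (rewrite sin2_cos2; field; lra).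
          unfold Rsqr; field; lra.
        * apply (is_derive_comp N sin); [apply DN | apply is_derive_sin].
    - apply Rnot_lt_le in P.
      assert (L : r * sin p < s1) by nra.
      rewrite (Z0 _ L), nu0 by lra.
      apply is_derive_ext_loc with (fun _ => 0).
      + assert (L' : locally p (fun q => r * sin q < s1)).
        { assert (C : cont (fun q => r * sin q)) by cont.
          apply (C p (fun y => y < s1)); now apply (open_lt s1). }
        revert L'; apply filter_imp; intros q Hq; eqR.
        rewrite Z0 by exact Hq; ring.
      + replace (0 - cos p ^ 2 * sin p ^ (2 * j) * 0) with 0 by ring.
        apply (is_derive_const (V := R_NormedModule)). }
  rewrite sin_PI, sin_0 in K; rewrite RInt_minusR in K by cont.
  unfold angular_int; lra.
Qed.

(** Since [sin ^ 2 = 1 - cos ^ 2], each factor [sin p ^ 2] can be dropped at the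
    cost of a term with [cos p ^ 2]. *)
Lemma negligible_sin_pow j :
  negligible (fun r => angular_int (fun p => sin p ^ (2 * j)) r - E0 r).
Proof.
  induction j as [| j IH].
  - apply negligible_ext with (fun _ => 0); [| apply negligible_zero].
    intros r; simpl; unfold E0; ring.
  - assert (K : negligible (angular_int (fun p => cos p ^ 2 * sin p ^ (2 * j)))).
    { destruct (negligible_mean _ (2 * j + 1)
        (cont_angular_int (fun p => sin p ^ (2 * j)) ltac:(cont))
        (angular_int_zero _) IH) as (C & HC & H).
      exists C; split; [exact HC |]; intros r Hr.
      rewrite angular_int_cos2 by lra; auto. }
    apply negligible_ext with (fun r =>
      (angular_int (fun p => sin p ^ (2 * j)) r - E0 r)
      - angular_int (fun p => cos p ^ 2 * sin p ^ (2 * j)) r);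
      [| now apply negligible_minus].
    intros r.
    rewrite (angular_int_ext (fun p => sin p ^ (2 * S j))
      (fun p => sin p ^ (2 * j) - cos p ^ 2 * sin p ^ (2 * j))).
    + rewrite (angular_int_minus (fun p => sin p ^ (2 * j))
        (fun p => cos p ^ 2 * sin p ^ (2 * j))) by cont; ring.
    + intros p; replace (2 * S j)%nat with (2 * j + 2)%nat by lia.
      rewrite pow_add; replace (sin p ^ 2) with (1 - cos p ^ 2); [ring |].
      rewrite <- (sin2_cos2 p); unfold Rsqr; ring.
Qed.

Lemma negligible_cos_sin_pow i : forall j,
  negligible (angular_int (fun p => cos p ^ (2 * S i) * sin p ^ (2 * j))).
Proof.
  assert (Step : forall (i j : nat), negligible (fun r =>
      angular_int (fun p => cos p ^ (2 * i) * sin p ^ (2 * j)) r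
      - angular_int (fun p => cos p ^ (2 * i) * sin p ^ (2 * S j)) r) ->
    negligible (angular_int (fun p => cos p ^ (2 * S i) * sin p ^ (2 * j)))).
  { clear i; intros i j; apply negligible_ext; intros r.
    rewrite <- (angular_int_minus (fun p => cos p ^ (2 * i) * sin p ^ (2 * j))
      (fun p => cos p ^ (2 * i) * sin p ^ (2 * S j))) by cont.
    apply angular_int_ext; intros p.
    replace (2 * S j)%nat with (2 * j + 2)%nat by lia.
    replace (2 * S i)%nat with (2 * i + 2)%nat by lia.
    rewrite !pow_add; replace (sin p ^ 2) with (1 - cos p ^ 2); [ring |].
    rewrite <- (sin2_cos2 p); unfold Rsqr; ring. }
  induction i as [| i IH]; intros j; apply Step.
  - apply negligible_ext with (fun r =>
      (angular_int (fun p => sin p ^ (2 * j)) r - E0 r)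
      - (angular_int (fun p => sin p ^ (2 * S j)) r - E0 r));
      [| apply negligible_minus; apply negligible_sin_pow].
    intros r; rewrite (angular_int_ext (fun p => cos p ^ (2 * 0) * sin p ^ (2 * j))
      (fun p => sin p ^ (2 * j))) by (intros; simpl; ring).
    rewrite (angular_int_ext (fun p => cos p ^ (2 * 0) * sin p ^ (2 * S j))
      (fun p => sin p ^ (2 * S j))) by (intros; simpl; ring).
    ring.
  - apply negligible_minus; apply IH.
Qed.

(** Integrating the Abel transform once more, against [sin b] at the radius
    [r * sin b], gives the integral over the sphere of [nu (r * x)] for a
    coordinate function [x]. By rotation invariance that coordinate may be
    taken along the axis, so the result is a multiple of the primitive of [nu]
    at [r]. *)
Lemma abel_injective : (forall r, 0 <= r <= d -> E0 r = 0) ->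
  forall s, 0 <= s <= d -> nu s = 0.
Proof.
  intros H; apply primitive_zero; [exact Cnu | exact d_pos |].
  intros r Hr.
  pose proof (sphere_int_symm (fun _ => 1) (fun _ => 0) (fun x => nu (r * x))
    (PI / 2) (cont_const 0)
    (fun x => is_derive_const (V := R_NormedModule) 1 x) ltac:(cont)) as K.
  cbv beta in K.
  replace (sphere_int (fun b t => 1 * nu (r * (cos b * cos (PI / 2)
    - sin b * sin (PI / 2) * cos t)))) with 0 in K.
  2: { symmetry; apply RInt_zero; pose proof PI_RGT_0 as HPI.
    rewrite Rmin_left, Rmax_right by lra; intros b Hb.
    rewrite RInt_scalR by cont.
    rewrite <- (RInt_period _ (2 * PI) (PI / 2)); [| cont |].
    2: { intros t; now rewrite cos_plus, cos_2PI, sin_2PI,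
        Rmult_1_r, Rmult_0_r, Rminus_0_r. }
    rewrite (RInt_extR _ (fun t => 1 * nu (r * sin b * sin t))).
    2: { intros t; rewrite cos_PI2, sin_PI2, cos_plus, cos_PI2, sin_PI2.
      do 2 f_equal; ring. }
    rewrite (RInt_chaslesR _ 0 PI) by cont.
    rewrite (RInt_zero _ PI).
    - assert (Hs : 0 <= sin b) by (apply sin_ge_0; lra).
      pose proof (SIN_bound b).
      pose proof (H (r * sin b)) as Z; unfold E0, angular_int in Z.
      rewrite Z; [ring | split; nra].
    - rewrite Rmin_left, Rmax_right by lra; intros t Ht.
      rewrite nu0; [ring |].
      assert (0 <= sin b) by (apply sin_ge_0; lra).
      assert (sin t <= 0) by (apply sin_le_0; lra).
      assert (0 <= r * sin b) by (apply Rmult_le_pos; lra); nra. }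
  unfold sphere_int in K.
  rewrite (RInt_extR _ (fun b => 2 * PI * (sin b * nu (r * cos b)))) in K.
  2: { intros b; rewrite (RInt_const (V := R_CompleteNormedModule)).
    change ((2 * PI - 0) * (sin b * (1 * nu (r * cos b)))
      = 2 * PI * (sin b * nu (r * cos b))); ring. }
  rewrite RInt_scalR in K by cont.
  rewrite (RInt_sin_cos (fun x => nu (r * x))) in K by cont.
  pose proof (RInt_affine nu r 0 (-1) 1 Cnu) as A.
  rewrite (RInt_extR (fun x => nu (r * x + 0)) (fun x => nu (r * x))) in A
    by (intros; now rewrite Rplus_0_r).
  pose proof PI_RGT_0 as HPI.
  assert (Z : RInt (fun x => nu (r * x)) (-1) 1 = 0).
  { apply (Rmult_eq_reg_l (2 * PI)); lra. }
  rewrite Z, (RInt_chaslesR nu _ 0) in A by exact Cnu.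
  rewrite (RInt_zero nu _ 0) in A.
  - rewrite Rmult_1_r, Rplus_0_r in A; lra.
  - rewrite Rmin_left, Rmax_right by lra; intros; apply nu0; lra.
Qed.

(** All terms with a power of the cosine are remainders; the first one is the
    Abel transform of [nu] up to a remainder. By Gronwall the Abel transform
    vanishes, hence so does [nu]. *)
Lemma volterra_unique (q : nat -> R) (n : nat) :
  q O <> 0 -> (forall i, (i <= 2 * n)%nat -> Nat.Odd i -> q i = 0) ->
  (forall r, 0 <= r <= d -> sum_f_R0 (fun k =>
    q k * angular_int (fun p => cos p ^ k * sin p ^ (2 * n - k)) r)
    (2 * n) = 0) ->
  forall s, 0 <= s <= d -> nu s = 0.
Proof.
  intros q0 qodd H; apply abel_injective.
  set (a := fun k => angular_int (fun p => cos p ^ k * sin p ^ (2 * n - k))) in *.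
  assert (S1 : forall m, (m <= 2 * n)%nat ->
    negligible (fun r => sum_f_R0 (fun k => q k * a k r) m - q O * E0 r)).
  { induction m as [| m IH]; intros Hm.
    - apply negligible_ext with
        (fun r => q O * (angular_int (fun p => sin p ^ (2 * n)) r - E0 r)).
      + intros r; cbn [sum_f_R0]; unfold a.
        rewrite (angular_int_ext (fun p => cos p ^ 0 * sin p ^ (2 * n - 0))
          (fun p => sin p ^ (2 * n))); [ring |].
        intros p; rewrite Nat.sub_0_r; simpl; ring.
      + apply negligible_scal, negligible_sin_pow.
    - apply negligible_ext with (fun r =>
        (sum_f_R0 (fun k => q k * a k r) m - q O * E0 r) + q (S m) * a (S m) r).
      { intros r; cbn [sum_f_R0]; ring. }
      apply negligible_plus; [apply IH; lia |].
      destruct (Nat.Even_or_Odd (S m)) as [[i Hi] | Ho].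
      + apply negligible_scal; unfold a; rewrite Hi.
        replace (2 * n - 2 * i)%nat with (2 * (n - i))%nat by lia.
        destruct i as [| i]; [lia |]; apply negligible_cos_sin_pow.
      + rewrite (qodd _ Hm Ho).
        apply negligible_ext with (fun _ => 0);
          [intros; ring | apply negligible_zero]. }
  assert (S2 : negligible E0).
  { destruct (S1 (2 * n)%nat (le_n _)) as (C & HC & K).
    apply negligible_ext with (fun r => / q O * (q O * E0 r)).
    { intros; field; exact q0. }
    apply negligible_scal; exists C; split; [exact HC |]; intros r Hr.
    specialize (K r Hr); unfold a in K; rewrite H in K by exact Hr.
    now rewrite Rminus_0_l, Rabs_Ropp in K. }
  destruct S2 as (C & HC & K).
  apply (gronwall E0 C d); auto; apply cont_angular_int; cont.
Qed.
End Volterra.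

(** * Moments *)

(** If [K 1 > 0], then [K] is bounded below by some [c > 0] on [[a, 1]]. The
    part of the integral over [[b, 1]] with [a < b] is at least
    [c * (1 - b) * b ^ (2 * n)], while the part over [[0, a]] is at most of the
    order of [a ^ (2 * n)], which is eventually smaller. *)
Lemma even_moments_endpoint_nonpos (K : R -> R) : cont K ->
  (forall n, RInt (fun x => K x * x ^ (2 * n)) 0 1 = 0) -> K 1 <= 0.
Proof.
  intros CK H; apply Rnot_lt_le; intros P.
  assert (P2 : 0 < K 1 / 2) by lra.
  pose proof (proj1 (filterlim_locally _ _) (CK 1) (mkposreal _ P2))
    as [[r Hr] B].
  set (a := Rmax 0 (1 - r / 2)); set (b := (a + 1) / 2).
  set (c := K 1 / 2) in *.
  assert (Ha : 0 <= a < 1 /\ 1 - r / 2 <= a).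
  { unfold a; split; [split |]; [apply Rmax_l | apply Rmax_lub_lt; lra |
      apply Rmax_r]. }
  assert (Hb : a < b < 1) by (unfold b; lra).
  assert (Kc : forall x, a <= x <= 1 -> c <= K x).
  { intros x Hx; specialize (B x); simpl in B.
    assert (Bx : ball (1 : R) r x).
    { change (Rabs (x - 1) < r); apply Rabs_def1; lra. }
    specialize (B Bx); change (Rabs (K x - K 1) < c) in B.
    apply Rabs_def2 in B; unfold c in *; lra. }
  set (S := RInt (fun x => Rabs (K x)) 0 a).
  assert (HS : 0 <= S).
  { apply RInt_ge_0; [lra | apply ex_RInt_cont; cont |].
    intros; apply Rabs_pos. }
  assert (Main : forall n, c * (1 - b) * b ^ (2 * n) <= S * a ^ (2 * n)).
  { intros n; specialize (H n).
    rewrite (RInt_chaslesR _ 0 a), (RInt_chaslesR _ a b) in H by cont.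
    assert (L1 : - (S * a ^ (2 * n)) <= RInt (fun x => K x * x ^ (2 * n)) 0 a).
    { unfold S.
      replace (- (RInt (fun x => Rabs (K x)) 0 a * a ^ (2 * n)))
        with (- a ^ (2 * n) * RInt (fun x => Rabs (K x)) 0 a) by ring.
      rewrite <- RInt_scalR by cont.
      apply RInt_le; [lra | apply ex_RInt_cont; cont |
        apply ex_RInt_cont; cont |].
      intros x Hx.
      assert (0 <= x ^ (2 * n) <= a ^ (2 * n)).
      { split; [apply pow_le | apply pow_incr]; lra. }
      pose proof (Rabs_pos (K x)); pose proof (Rle_abs (- K x)) as T.
      rewrite Rabs_Ropp in T; nra. }
    assert (L2 : 0 <= RInt (fun x => K x * x ^ (2 * n)) a b).
    { apply RInt_ge_0; [lra | apply ex_RInt_cont; cont |]; intros x Hx.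
      apply Rmult_le_pos; [| apply pow_le; lra].
      specialize (Kc x); lra. }
    assert (L3 : c * (1 - b) * b ^ (2 * n)
      <= RInt (fun x => K x * x ^ (2 * n)) b 1).
    { apply Rle_trans with (RInt (fun _ => c * b ^ (2 * n)) b 1).
      - rewrite RInt_const.
        change (c * (1 - b) * b ^ (2 * n) <= (1 - b) * (c * b ^ (2 * n))); lra.
      - apply RInt_le; [lra | apply ex_RInt_cont; cont |
          apply ex_RInt_cont; cont |].
        intros x Hx.
        assert (0 <= b ^ (2 * n) <= x ^ (2 * n)).
        { split; [apply pow_le | apply pow_incr]; lra. }
        assert (c <= K x) by (apply Kc; lra); unfold c in *.
        apply Rmult_le_compat; lra. }
    lra. }
  assert (Hq : Rabs (a / b) < 1).
  { rewrite Rabs_pos_eq.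
    - apply (Rmult_lt_reg_r b); [lra |]; unfold Rdiv.
      rewrite Rmult_assoc, Rinv_l; lra.
    - apply Rmult_le_pos; [lra | left; apply Rinv_0_lt_compat; lra]. }
  assert (Hy : 0 < c * (1 - b) / (S + 1)).
  { apply Rdiv_lt_0_compat; [apply Rmult_lt_0_compat |]; lra. }
  destruct (pow_lt_1_zero (a / b) Hq _ Hy) as [N HN].
  specialize (HN (2 * N)%nat ltac:(lia)); specialize (Main N).
  apply Rabs_def2 in HN; destruct HN as [HN _].
  assert (Hbp : 0 < b ^ (2 * N)) by (apply pow_lt; lra).
  assert (E : (a / b) ^ (2 * N) * b ^ (2 * N) = a ^ (2 * N)).
  { rewrite <- Rpow_mult_distr; f_equal; field; lra. }
  rewrite <- E in Main.
  assert (Q : c * (1 - b) <= S * (a / b) ^ (2 * N)).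
  { apply (Rmult_le_reg_r (b ^ (2 * N))); [exact Hbp | lra]. }
  assert (Q2 : (a / b) ^ (2 * N) * (S + 1) < c * (1 - b)).
  { apply Rmult_lt_reg_r with (/ (S + 1)); [apply Rinv_0_lt_compat; lra |].
    rewrite Rmult_assoc, Rinv_r, Rmult_1_r by lra; exact HN. }
  assert (0 <= (a / b) ^ (2 * N)).
  { apply pow_le, Rmult_le_pos; [lra | left; apply Rinv_0_lt_compat; lra]. }
  lra.
Qed.

Lemma even_moments_endpoint (h : R -> R) : cont h ->
  (forall n, RInt (fun b => sin b * (h (cos b) * cos b ^ (2 * n))) 0 PI = 0) ->
  h 1 + h (-1) = 0.
Proof.
  intros Ch H.
  set (K := fun x => h x + h (- x)).
  assert (CK : cont K) by (unfold K; cont).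
  assert (HK : forall n, RInt (fun x => K x * x ^ (2 * n)) 0 1 = 0).
  { intros n.
    rewrite (RInt_extR _ (fun x => h x * x ^ (2 * n) + h (- x) * x ^ (2 * n)))
      by (intros; unfold K; ring).
    rewrite RInt_plusR by cont.
    apply eq_trans with (2 := H n).
    rewrite (RInt_sin_cos (fun x => h x * x ^ (2 * n))) by cont.
    rewrite (RInt_chaslesR _ (-1) 0 1), Rplus_comm by cont; f_equal.
    pose proof (RInt_affine (fun x => h x * x ^ (2 * n)) (-1) 0 0 1
      ltac:(cont)) as A.
    replace (-1 * 0 + 0) with 0 in A by ring.
    replace (-1 * 1 + 0) with (-1) in A by ring.
    rewrite (RInt_swapR _ 0 (-1)), <- A by cont.
    rewrite (RInt_extR (fun x => h (-1 * x + 0) * (-1 * x + 0) ^ (2 * n))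
      (fun x => h (- x) * x ^ (2 * n))); [symmetry; eqR; ring |].
    intros x; replace (-1 * x + 0) with (- x) by ring; f_equal.
    rewrite !pow_mult; f_equal; ring. }
  assert (K1 : K 1 = 0).
  { apply Rle_antisym; [now apply even_moments_endpoint_nonpos |].
    enough (- K 1 <= 0) by lra.
    apply (even_moments_endpoint_nonpos (fun x => - K x)); [cont |].
    intros n; rewrite (RInt_extR _ (fun x => -1 * (K x * x ^ (2 * n))))
      by (intros; ring).
    rewrite RInt_scalR, HK by cont; apply Rmult_0_r. }
  exact K1.
Qed.

Definition cos_moment (k : nat) : R := RInt (fun t => cos t ^ k) 0 (2 * PI).

Lemma cos_moment_odd k : Nat.Odd k -> cos_moment k = 0.
Proof.
  intros [m Hm]; unfold cos_moment.
  pose proof (RInt_period (fun t => cos t ^ k) (2 * PI) PI ltac:(cont)) as H.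
  assert (E : RInt (fun x => cos (x + PI) ^ k) 0 (2 * PI)
    = -1 * RInt (fun t => cos t ^ k) 0 (2 * PI)).
  { rewrite <- RInt_scalR by cont; apply RInt_extR; intros t.
    rewrite neg_cos; replace (- cos t) with (-1 * cos t) by ring.
    rewrite Rpow_mult_distr, Hm, pow_add, pow_1_even; ring. }
  cbv beta in H; rewrite E in H.
  assert (-1 * RInt (fun t => cos t ^ k) 0 (2 * PI)
    = RInt (fun t => cos t ^ k) 0 (2 * PI)).
  { apply H; intros; now rewrite cos_plus, cos_2PI, sin_2PI,
      Rmult_1_r, Rmult_0_r, Rminus_0_r. }
  lra.
Qed.

Lemma cos_moment_even n : 0 < cos_moment (2 * n).
Proof.
  unfold cos_moment; pose proof PI_RGT_0.
  rewrite (RInt_chaslesR _ 0 (PI / 2)) by cont.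
  assert (0 < RInt (fun t => cos t ^ (2 * n)) 0 (PI / 2)).
  { apply RInt_gt_0; [lra | | intros t Ht].
    - intros t Ht; apply pow_lt, cos_gt_0; lra.
    - apply (cont_pow cos (2 * n) (fun t => continuous_cos t)). }
  assert (0 <= RInt (fun t => cos t ^ (2 * n)) (PI / 2) (2 * PI)).
  { apply RInt_ge_0; [lra | apply ex_RInt_cont; cont |].
    intros t _; rewrite pow_mult; apply pow_le, pow2_ge_0. }
  lra.
Qed.

(** * The transform of a function and its latitude integrals *)

(** The integral of [g] over the circle of latitude at height [rho * x] on the
    sphere of radius [rho]. For [x] outside [[-1, 1]] the square root is [0], so
    the function remains continuous on the whole line. *)
Definition latitude_int (g : R3 -> R) (rho x : R) : R :=
  RInt (fun a => g (rho * sqrt (1 - x ^ 2) * cos a,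
                    rho * sqrt (1 - x ^ 2) * sin a, rho * x)) 0 (2 * PI).

(** Turning the axis of the apple about the [x3]-axis moves each of its points
    along a circle of latitude, and the integral over this circle depends only
    on the height of the point. *)
Lemma RInt_rot_polar (g : R3 -> R) (rho b t p : R) : cont g ->
  RInt (fun a => polar (act (rot a b) g) rho t p) 0 (2 * PI)
  = latitude_int g rho (cos b * cos p - sin b * sin p * cos t).
Proof.
  intros Cg.
  set (y := rotV b (sin p * cos t, sin p * sin t, cos p)).
  assert (Hy : dot y y = 1).
  { unfold y; rewrite rotV_dot; simpl.
    transitivity (sin p * sin p * (cos t * cos t + sin t * sin t)
      + cos p * cos p); [ring |].
    rewrite (cos2_sin2 t), Rmult_1_r, Rplus_comm; apply cos2_sin2. }
  destruct (sphere_param y Hy) as (a0 & b0 & _ & Hb0 & E).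
  rewrite rot_north_pole in E.
  assert (E3 : cos b * cos p - sin b * sin p * cos t = cos b0).
  { transitivity (- sin b * (sin p * cos t) + cos b * cos p); [ring |].
    exact (f_equal snd E). }
  assert (E1 : cos b * (sin p * cos t) + sin b * cos p = sin b0 * cos a0).
  { exact (f_equal (fun z => fst (fst z)) E). }
  assert (E2 : sin p * sin t = sin b0 * sin a0).
  { exact (f_equal (fun z => snd (fst z)) E). }
  assert (Es : sqrt (1 - cos b0 ^ 2) = sin b0).
  { replace (1 - cos b0 ^ 2) with (sin b0 ^ 2)
      by (rewrite <- (cos2_sin2 b0); ring).
    apply sqrt_pow2, sin_ge_0; lra. }
  rewrite E3; unfold latitude_int; rewrite Es.
  rewrite <- (RInt_period (fun a => g (rho * sin b0 * cos a,
    rho * sin b0 * sin a, rho * cos b0)) (2 * PI) a0); [| cont |].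
  - apply RInt_extR; intros a; unfold polar, act, rot, rotU, rotV; f_equal.
    rewrite cos_plus, sin_plus; triple.
    + transitivity (rho * (cos a * (cos b * (sin p * cos t) + sin b * cos p)
        - sin a * (sin p * sin t))); [ring | rewrite E1, E2; ring].
    + transitivity (rho * (sin a * (cos b * (sin p * cos t) + sin b * cos p)
        + cos a * (sin p * sin t))); [ring | rewrite E1, E2; ring].
    + rewrite <- E3; ring.
  - intros x; f_equal; now rewrite cos_plus, sin_plus, cos_2PI, sin_2PI,
      !Rmult_1_r, !Rmult_0_r, Rminus_0_r, Rplus_0_r.
Qed.

Lemma cont_latitude_int g :
  cont g -> cont (fun p : R * R => latitude_int g (fst p) (snd p)).
Proof. intros Cg; unfold latitude_int; cont. Qed.

Definition apple_weight (r p : R) : R :=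
  apple_radius r p ^ 2 * sin p * sqrt ((1 + r ^ 2) / (1 + r ^ 2 * sin p ^ 2)).

Lemma cont_apple_weight r : cont (apple_weight r).
Proof.
  unfold apple_weight, apple_radius; cont; apply cont_div; cont.
  intros p; pose proof (pow2_ge_0 (r * sin p)) as H.
  rewrite Rpow_mult_distr in H; lra.
Qed.

Lemma cont_apple_radius r : cont (apple_radius r).
Proof. unfold apple_radius; cont. Qed.

Lemma RInt_apple (g : R3 -> R) (r b : R) : cont g ->
  RInt (fun a => apple g r a b) 0 (2 * PI)
  = RInt (fun p => apple_weight r p *
      RInt (fun t => latitude_int g (apple_radius r p)
        (cos b * cos p - sin b * sin p * cos t)) 0 (2 * PI)) 0 PI.
Proof.
  intros Cg.
  pose proof (cont_apple_weight r) as Cw.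
  pose proof (cont_apple_radius r) as Cr.
  pose proof (cont_latitude_int g Cg) as Cl.
  unfold apple, polar, act, rot, rotU, rotV.
  change (RInt (fun a => RInt (fun t => RInt (fun p => apple_weight r p
      * polar (act (rot a b) g) (apple_radius r p) t p) 0 PI)
      0 (2 * PI)) 0 (2 * PI) = RInt (fun p => apple_weight r p *
      RInt (fun t => latitude_int g (apple_radius r p)
      (cos b * cos p - sin b * sin p * cos t)) 0 (2 * PI)) 0 PI).
  rewrite (RInt_fubini (fun a t => RInt (fun p => apple_weight r p
      * polar (act (rot a b) g) (apple_radius r p) t p) 0 PI))
    by (unfold polar, act, rot, rotU, rotV; cont).
  rewrite (RInt_extR _ (fun t => RInt (fun p => apple_weight r p *
    latitude_int g (apple_radius r p) (cos b * cos p - sin b * sin p * cos t)) 0 PI)).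
  2: { intros t; rewrite (RInt_fubini (fun a p => apple_weight r p
      * polar (act (rot a b) g) (apple_radius r p) t p))
      by (unfold polar, act, rot, rotU, rotV; cont).
    apply RInt_extR; intros p.
    rewrite RInt_scalR, RInt_rot_polar; [easy | easy |].
    unfold polar, act, rot, rotU, rotV; cont. }
  rewrite (RInt_fubini (fun t p => apple_weight r p *
    latitude_int g (apple_radius r p) (cos b * cos p - sin b * sin p * cos t)))
    by cont.
  apply RInt_extR; intros p; apply RInt_scalR; cont.
Qed.

Lemma is_derive_pow_id n x :
  is_derive (fun y => y ^ n) x (INR n * x ^ pred n).
Proof. auto_derive; trivial; ring. Qed.

(** The transform is tested against [cos b ^ n] on the sphere of axes, and
    [sphere_int_symm] moves the average over circles from [g] to this test
    function. *)
Lemma apple_moment (g : R3 -> R) (r : R) (n : nat) : cont g ->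
  (forall a b, 0 <= a <= 2 * PI -> 0 <= b <= PI -> apple g r a b = 0) ->
  RInt (fun p => apple_weight r p * sphere_int (fun b t =>
    (cos b * cos p - sin b * sin p * cos t) ^ n
    * latitude_int g (apple_radius r p) (cos b))) 0 PI = 0.
Proof.
  intros Cg H; pose proof PI_RGT_0 as HPI.
  pose proof (cont_apple_weight r) as Cw.
  pose proof (cont_apple_radius r) as Cr.
  pose proof (cont_latitude_int g Cg) as Cl.
  rewrite (RInt_extR _ (fun p => RInt (fun b => apple_weight r p * RInt (fun t =>
    sin b * (cos b ^ n * latitude_int g (apple_radius r p)
      (cos b * cos p - sin b * sin p * cos t))) 0 (2 * PI)) 0 PI)).
  2: { intros p; rewrite RInt_scalR by cont; f_equal; symmetry.
    apply (sphere_int_symm (fun x => x ^ n) (fun x => INR n * x ^ pred n)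
      (latitude_int g (apple_radius r p)) p); [cont | apply is_derive_pow_id | cont]. }
  rewrite (RInt_fubini (fun p b => apple_weight r p * RInt (fun t =>
    sin b * (cos b ^ n * latitude_int g (apple_radius r p)
      (cos b * cos p - sin b * sin p * cos t))) 0 (2 * PI))) by cont.
  apply RInt_zero; rewrite Rmin_left, Rmax_right by lra; intros b Hb.
  rewrite (RInt_extR _ (fun p => sin b * cos b ^ n * (apple_weight r p *
    RInt (fun t => latitude_int g (apple_radius r p)
      (cos b * cos p - sin b * sin p * cos t)) 0 (2 * PI)))).
  - rewrite RInt_scalR by cont; rewrite <- RInt_apple by exact Cg.
    rewrite RInt_zero; [ring |].
    rewrite Rmin_left, Rmax_right by lra; intros a Ha; apply H; lra.
  - intros p; rewrite <- (RInt_scalR _ (apple_weight r p)) by cont.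
    rewrite <- (RInt_scalR _ (apple_weight r p)) by cont.
    rewrite <- RInt_scalR by cont.
    apply RInt_extR; intros; ring.
Qed.

(** The integral of [h x * x ^ i * sqrt (1 - x ^ 2) ^ j] over [[-1, 1]], with
    [x = cos b]. *)
Definition moment (h : R -> R) (i j : nat) : R :=
  RInt (fun b => sin b * h (cos b) * (cos b ^ i * sin b ^ j)) 0 PI.

(** When the even moments of order below [2 * n] vanish, a factor
    [sin b ^ 2 = 1 - cos b ^ 2] in a moment of total order [2 * n] acts as
    [- cos b ^ 2]. *)
Lemma moment_even (h : R -> R) (n : nat) : cont h ->
  (forall i, (i < n)%nat -> moment h (2 * i) 0 = 0) ->
  forall j i, ((i + j < n)%nat -> moment h (2 * i) (2 * j) = 0) /\
    ((i + j = n)%nat ->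
      moment h (2 * i) (2 * j) = (-1) ^ j * moment h (2 * n) 0).
Proof.
  intros Ch H; induction j as [| j IH]; intros i.
  - split; intros Hi; [apply H; lia |].
    replace n with i by lia; rewrite Nat.mul_0_r; simpl; ring.
  - assert (E : moment h (2 * i) (2 * S j)
      = moment h (2 * i) (2 * j) - moment h (2 * S i) (2 * j)).
    { unfold moment; rewrite <- RInt_minusR by cont.
      apply RInt_extR; intros b.
      replace (2 * S j)%nat with (2 * j + 2)%nat by lia.
      replace (2 * S i)%nat with (2 * i + 2)%nat by lia.
      rewrite !pow_add; replace (sin b ^ 2) with (1 - cos b ^ 2); [ring |].
      rewrite <- (cos2_sin2 b); ring. }
    rewrite E; split; intros Hi.
    + rewrite (proj1 (IH i)), (proj1 (IH (S i))) by lia; ring.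
    + rewrite (proj1 (IH i)), (proj2 (IH (S i))) by lia; simpl; ring.
Qed.

(** The sum of [zonal_coef n k * cos p ^ k * sin p ^ (2 * n - k)] over [k] is
    [2 * PI] times the Legendre polynomial of degree [2 * n] at [cos p]
    (Laplace's integral formula). The quotient [Nat.div2 k] is used for even [k]
    only: for odd [k] the cosine moment is [0]. *)
Definition zonal_coef (n k : nat) : R :=
  Binomial.C (2 * n) k * cos_moment (2 * n - k) * (-1) ^ (n - Nat.div2 k).

(** Expand the power by the binomial formula and integrate over [t]: odd powers
    of [cos t] drop out, and by [moment_even] the remaining terms all carry the
    same moment. *)
Lemma sphere_int_zonal (h : R -> R) (n : nat) (p : R) : cont h ->
  (forall i, (i < n)%nat -> moment h (2 * i) 0 = 0) ->
  sphere_int (fun b t =>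
    (cos b * cos p - sin b * sin p * cos t) ^ (2 * n) * h (cos b))
  = sum_f_R0 (fun k => zonal_coef n k * (cos p ^ k * sin p ^ (2 * n - k)))
      (2 * n) * moment h (2 * n) 0.
Proof.
  intros Ch H; unfold sphere_int.
  set (c := fun k => Binomial.C (2 * n) k * (-1) ^ (2 * n - k)
    * (cos p ^ k * sin p ^ (2 * n - k))).
  rewrite (RInt_extR _ (fun b => sum_f_R0 (fun k =>
    c k * cos_moment (2 * n - k)
    * (sin b * h (cos b) * (cos b ^ k * sin b ^ (2 * n - k)))) (2 * n))).
  2: { intros b.
    rewrite (RInt_extR _ (fun t => sum_f_R0 (fun k =>
      c k * (sin b * h (cos b) * (cos b ^ k * sin b ^ (2 * n - k)))
        * cos t ^ (2 * n - k)) (2 * n))).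
    - rewrite (RInt_sum (fun k t =>
        c k * (sin b * h (cos b) * (cos b ^ k * sin b ^ (2 * n - k)))
        * cos t ^ (2 * n - k))) by (intros; cont).
      apply sum_eq; intros k _; rewrite RInt_scalR by cont.
      unfold cos_moment; ring.
    - intros t.
      replace (cos b * cos p - sin b * sin p * cos t)
        with (cos b * cos p + -1 * sin b * sin p * cos t) by ring.
      rewrite binomial.
      transitivity (sin b * h (cos b) * sum_f_R0 (fun i =>
        Binomial.C (2 * n) i * (cos b * cos p) ^ i
        * (-1 * sin b * sin p * cos t) ^ (2 * n - i)) (2 * n)); [ring |].
      rewrite scal_sum; apply sum_eq; intros k _; unfold c.
      rewrite !Rpow_mult_distr; ring. }
  rewrite (RInt_sum (fun k b => c k * cos_moment (2 * n - k)
    * (sin b * h (cos b) * (cos b ^ k * sin b ^ (2 * n - k)))))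
    by (intros; cont).
  rewrite Rmult_comm, scal_sum; apply sum_eq; intros k Hk.
  rewrite RInt_scalR by cont.
  change (c k * cos_moment (2 * n - k) * moment h k (2 * n - k)
    = zonal_coef n k * (cos p ^ k * sin p ^ (2 * n - k))
      * moment h (2 * n) 0).
  unfold c, zonal_coef.
  destruct (Nat.Even_or_Odd k) as [[i Ei] | [i Ei]].
  - assert (E : (2 * n - k = 2 * (n - i))%nat) by lia.
    rewrite E, Ei, Nat.div2_double.
    rewrite (proj2 (moment_even h n Ch H (n - i) i)) by lia.
    rewrite pow_1_even; ring.
  - rewrite cos_moment_odd; [ring |]; exists (n - i - 1)%nat; lia.
Qed.

(** * Vanishing of the even moments *)

(** The radius of a point of the apple in terms of [s = r * sin p]. It is the
    inverse of [rho |-> (rho - 1 / rho) / 2]; this is why [delta] corresponds to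
    the radius [eps]. *)
Definition outer_radius (s : R) : R := sqrt (s ^ 2 + 1) + s.

Lemma apple_radius_eq r p : apple_radius r p = outer_radius (r * sin p).
Proof. unfold apple_radius, outer_radius; now rewrite Rpow_mult_distr. Qed.

Lemma outer_radius_pos s : 0 < outer_radius s.
Proof.
  unfold outer_radius.
  assert (H : 0 <= s ^ 2 + 1) by nra.
  pose proof (sqrt_pos (s ^ 2 + 1)) as P; pose proof (pow2_sqrt _ H) as Q.
  nra.
Qed.

Lemma outer_radius_le s e :
  0 < e -> s <= (e ^ 2 - 1) / (2 * e) -> outer_radius s <= e.
Proof.
  intros He Hs; unfold outer_radius.
  assert (K : 2 * e * s <= e ^ 2 - 1).
  { replace (e ^ 2 - 1) with (2 * e * ((e ^ 2 - 1) / (2 * e))) by (field; lra).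
    apply Rmult_le_compat_l; lra. }
  assert (0 <= e - s) by nra.
  enough (sqrt (s ^ 2 + 1) <= e - s) by lra.
  rewrite <- (sqrt_pow2 (e - s)) by assumption; apply sqrt_le_1_alt; nra.
Qed.

Lemma outer_radius_inv e : 0 < e -> outer_radius ((e ^ 2 - 1) / (2 * e)) = e.
Proof.
  intros He; unfold outer_radius.
  replace (((e ^ 2 - 1) / (2 * e)) ^ 2 + 1) with (((e ^ 2 + 1) / (2 * e)) ^ 2)
    by (field; lra).
  rewrite sqrt_pow2; [field; lra |].
  apply Rmult_le_pos; [nra | left; apply Rinv_0_lt_compat; lra].
Qed.

Lemma cont_outer_radius : cont outer_radius.
Proof. unfold outer_radius; cont. Qed.

Lemma latitude_int_zero g rho x e : (forall y, norm3 y <= e -> g y = 0) ->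
  0 <= rho <= e -> -1 <= x <= 1 -> latitude_int g rho x = 0.
Proof.
  intros H Hr Hx; apply RInt_zero; intros a _; apply H; simpl.
  assert (Q : 0 <= 1 - x * (x * 1)) by nra.
  pose proof (sqrt_sqrt _ Q) as S; set (s := sqrt (1 - x * (x * 1))) in *.
  apply Rle_trans with (sqrt (rho ^ 2)).
  - right; f_equal.
    transitivity (rho ^ 2 * (s * s * (cos a * cos a + sin a * sin a) + x * x));
      [ring |].
    rewrite cos2_sin2, S; ring.
  - rewrite sqrt_pow2; lra.
Qed.

(** Strong induction on [n]: each order gives one Volterra equation for the
    moment of order [2 * n], as a function of the radius. *)
Lemma moments_vanish (g : R3 -> R) (e1 e : R) : cont g -> 1 < e1 <= e ->
  (forall x, norm3 x <= e1 -> g x = 0) ->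
  (forall r a b, 0 <= r <= (e ^ 2 - 1) / (2 * e) ->
    0 <= a <= 2 * PI -> 0 <= b <= PI -> apple g r a b = 0) ->
  forall n rho, 0 <= rho <= e -> moment (latitude_int g rho) (2 * n) 0 = 0.
Proof.
  intros Cg He Hg HA n.
  pose proof (cont_latitude_int g Cg) as Cl; pose proof cont_outer_radius as Cr.
  induction n as [n IH] using (well_founded_induction Wf_nat.lt_wf).
  assert (Small : forall rho, 0 <= rho <= e1 ->
    moment (latitude_int g rho) (2 * n) 0 = 0).
  { intros rho Hr; apply RInt_zero; intros b _.
    rewrite (latitude_int_zero g rho (cos b) e1 Hg Hr) by apply COS_bound; ring. }
  (* The weight of the transform is [sqrt (1 + r ^ 2) / r] times a function of
     [s = r * sin p]; the latter is absorbed in the unknown [nu]. *)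
  set (nu := fun s => s * outer_radius s ^ 2 / sqrt (1 + s ^ 2)
    * moment (latitude_int g (outer_radius s)) (2 * n) 0).
  assert (Sq : forall s, 0 < sqrt (1 + s ^ 2)).
  { intros s; apply sqrt_lt_R0; pose proof (pow2_ge_0 s); lra. }
  assert (Cnu : cont nu).
  { unfold nu, moment; apply cont_mult; [apply cont_div |]; cont.
    intros s; pose proof (Sq s); lra. }
  set (s1 := (e1 ^ 2 - 1) / (2 * e1)); set (d := (e ^ 2 - 1) / (2 * e)) in *.
  assert (Hs1 : 0 < s1) by (apply Rdiv_lt_0_compat; nra).
  assert (Hd : 0 < d) by (apply Rdiv_lt_0_compat; nra).
  assert (nu0 : forall s, s <= s1 -> nu s = 0).
  { intros s Hs; unfold nu; rewrite Small; [ring |].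
    split; [left; apply outer_radius_pos | apply outer_radius_le; [lra | exact Hs]]. }
  assert (V : forall s, 0 <= s <= d -> nu s = 0).
  { apply (volterra_unique nu s1 d Cnu Hs1 Hd nu0 (zonal_coef n) n).
    - unfold zonal_coef; rewrite C_n_0, Nat.sub_0_r; simpl Nat.div2.
      rewrite Nat.sub_0_r.
      pose proof (cos_moment_even n).
      pose proof (pow_nonzero (-1) n ltac:(lra)).
      apply Rmult_integral_contrapositive; split; [lra | assumption].
    - intros i Hi [j Hj]; unfold zonal_coef.
      rewrite cos_moment_odd; [ring |]; exists (n - j - 1)%nat; lia.
    - intros r Hr.
      pose proof (apple_moment g r (2 * n) Cg (fun a b => HA r a b Hr)) as K.
      unfold angular_int.
      transitivity (RInt (fun p => sum_f_R0 (fun k =>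
        zonal_coef n k * (cos p ^ k * sin p ^ (2 * n - k) * nu (r * sin p)))
        (2 * n)) 0 PI).
      { rewrite (RInt_sum (fun k p => zonal_coef n k *
          (cos p ^ k * sin p ^ (2 * n - k) * nu (r * sin p)))) by (intros; cont).
        apply sum_eq; intros k _; rewrite RInt_scalR by cont; ring. }
      transitivity (r / sqrt (1 + r ^ 2) * RInt (fun p => apple_weight r p *
        sphere_int (fun b t =>
          (cos b * cos p - sin b * sin p * cos t) ^ (2 * n)
          * latitude_int g (apple_radius r p) (cos b))) 0 PI); [| rewrite K; ring].
      pose proof (cont_apple_weight r) as Cw.
      pose proof (cont_apple_radius r) as Ca.
      rewrite <- RInt_scalR by (unfold sphere_int; cont).
      apply RInt_ext; pose proof PI_RGT_0.
      rewrite Rmin_left, Rmax_right by lra; intros p Hp.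
      assert (Hs : 0 <= sin p <= 1).
      { split; [apply sin_ge_0; lra | apply SIN_bound]. }
      rewrite apple_radius_eq, sphere_int_zonal.
      + unfold nu, apple_weight; rewrite apple_radius_eq, sqrt_div_alt.
        2: { pose proof (pow2_ge_0 (r * sin p)) as P.
          rewrite Rpow_mult_distr in P; lra. }
        rewrite Rpow_mult_distr.
        pose proof (Sq r); pose proof (Sq (r * sin p)) as P2.
        rewrite Rpow_mult_distr in P2.
        set (m := moment _ _ _).
        transitivity (r * sin p * outer_radius (r * sin p) ^ 2
          / sqrt (1 + r ^ 2 * sin p ^ 2) * m * sum_f_R0 (fun k =>
            zonal_coef n k * (cos p ^ k * sin p ^ (2 * n - k))) (2 * n)).
        * rewrite scal_sum; apply sum_eq; intros k _; ring.
        * eqR; field; split; lra.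
      + cont.
      + intros i Hi; apply (IH i Hi).
        split; [left; apply outer_radius_pos |]; apply outer_radius_le; [lra |].
        fold d; nra. }
  intros rho Hr.
  destruct (Rle_dec rho e1) as [L | L]; [apply Small; lra |].
  set (s := (rho ^ 2 - 1) / (2 * rho)).
  assert (Hs : 0 < s) by (apply Rdiv_lt_0_compat; nra).
  assert (Er : outer_radius s = rho) by (apply outer_radius_inv; lra).
  assert (Hsd : s <= d).
  { apply Rnot_lt_le; intros N.
    assert (outer_radius d < outer_radius s).
    { unfold outer_radius; apply Rplus_le_lt_compat; [| exact N].
      apply sqrt_le_1_alt; nra. }
    unfold d in *; rewrite outer_radius_inv, Er in * by lra; lra. }
  specialize (V s ltac:(lra)); unfold nu in V; rewrite Er in V.
  apply Rmult_integral in V; destruct V as [V | V]; [exfalso | exact V].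
  assert (0 < s * rho ^ 2 / sqrt (1 + s ^ 2)); [| lra].
  apply Rdiv_lt_0_compat; [| apply Sq].
  apply Rmult_lt_0_compat; [exact Hs | apply pow_lt; lra].
Qed.

(** * The kernel of the transform *)

(** By Euler's angles, the composite of two rotations is a rotation of the form
    [rot a' b'] up to a turn about the axis of the apple, that is, a shift of
    the azimuth, which the integral does not see. *)
Lemma apple_rot (g : R3 -> R) (a0 b0 r a b : R) : cont g ->
  exists a' b', 0 <= a' <= 2 * PI /\ 0 <= b' <= PI /\
    apple (act (rot a0 b0) g) r a b = apple g r a' b'.
Proof.
  intros Cg.
  destruct (rot_rot a0 b0 a b) as (a' & b' & t0 & Ha & Hb & E).
  exists a', b'; split; [exact Ha | split; [exact Hb |]].
  pose proof (cont_apple_weight r) as Cw.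
  pose proof (cont_apple_radius r) as Cr.
  set (k := fun t => RInt (fun p => apple_weight r p
    * polar (act (rot a' b') g) (apple_radius r p) t p) 0 PI).
  transitivity (RInt (fun t => k (t + t0)) 0 (2 * PI)).
  - apply RInt_extR; intros t; apply RInt_extR; intros p.
    change (apple_weight r p * g (rot a0 b0 (rot a b (apple_radius r p * sin p * cos t,
      apple_radius r p * sin p * sin t, apple_radius r p * cos p)))
      = apple_weight r p * polar (act (rot a' b') g) (apple_radius r p) (t + t0) p).
    rewrite E; unfold polar, act; do 3 f_equal; unfold rotU.
    rewrite cos_plus, sin_plus; triple; ring.
  - apply (RInt_period k).
    + unfold k, polar, act, rot, rotU, rotV; cont.
    + intros t; unfold k, polar; now rewrite cos_plus, sin_plus, cos_2PI,
        sin_2PI, !Rmult_1_r, !Rmult_0_r, Rminus_0_r, Rplus_0_r.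
Qed.

Lemma latitude_int_pole g rho x :
  x ^ 2 = 1 -> latitude_int g rho x = 2 * PI * g (0, 0, rho * x).
Proof.
  intros Hx; unfold latitude_int; rewrite Hx, Rminus_diag, sqrt_0.
  rewrite (RInt_extR _ (fun _ => g (0, 0, rho * x))).
  - rewrite RInt_const.
    change ((2 * PI - 0) * g (0, 0, rho * x) = 2 * PI * g (0, 0, rho * x)); ring.
  - intros a; f_equal; triple; ring.
Qed.

Definition opp3 (x : R3) : R3 := let '(x1, x2, x3) := x in (- x1, - x2, - x3).

Lemma cont_rot a b : cont (rot a b).
Proof.
  intros x; apply continuous_ext with (fun x : R3 =>
    rotU a (rotV b (fst (fst x), snd (fst x), snd x))).
  - now intros [[x1 x2] x3].
  - revert x; change (cont (fun x : R3 =>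
      rotU a (rotV b (fst (fst x), snd (fst x), snd x)))).
    unfold rotU, rotV; cont.
Qed.

Lemma norm3_rot a b x : norm3 (rot a b x) = norm3 x.
Proof.
  assert (E : forall y, norm3 y = sqrt (dot y y)).
  { intros [[y1 y2] y3]; simpl; f_equal; ring. }
  now rewrite !E, rot_dot.
Qed.

(** A rotation brings [x] to the [x3]-axis. The circles of latitude at the two
    poles of the sphere through [x] are points, namely [x] and its antipode, so
    the vanishing of the even moments there becomes the claim. Nothing more can
    be expected: apples are symmetric about the origin, so odd functions have
    transform [0]. *)
Lemma apple_kernel_odd (g : R3 -> R) (e1 e : R) : cont g -> 1 < e1 <= e ->
  (forall x, norm3 x <= e1 -> g x = 0) ->
  (forall r a b, 0 <= r <= (e ^ 2 - 1) / (2 * e) ->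
    0 <= a <= 2 * PI -> 0 <= b <= PI -> apple g r a b = 0) ->
  forall x, norm3 x <= e -> g x + g (opp3 x) = 0.
Proof.
  intros Cg He Hg HA x Hx.
  set (rho := norm3 x) in *.
  assert (P : exists a b, x = rot a b (0, 0, rho)).
  { destruct x as [[x1 x2] x3].
    assert (Hr : rho * rho = x1 * x1 + x2 * x2 + x3 * x3).
    { unfold rho, norm3; rewrite sqrt_sqrt by nra; ring. }
    destruct (Req_dec rho 0) as [Z | N].
    - exists 0, 0; rewrite Z in *.
      assert (x1 = 0 /\ x2 = 0 /\ x3 = 0) as (-> & -> & ->)
        by (repeat split; nra).
      unfold rot; simpl; triple; ring.
    - destruct (sphere_param (x1 / rho, x2 / rho, x3 / rho))
        as (a & b & _ & _ & E).
      + simpl; transitivity ((x1 * x1 + x2 * x2 + x3 * x3) / (rho * rho));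
          [field; exact N |].
        rewrite <- Hr; field; exact N.
      + exists a, b.
        replace (0, 0, rho) with (lin_comb rho (0, 0, 1) 0 (0, 0, 0))
          by (simpl; triple; ring).
        rewrite rot_lin, <- E; unfold rot; simpl; triple; field; exact N. }
  destruct P as (a0 & b0 & Ex).
  set (h := act (rot a0 b0) g).
  assert (Ch : cont h) by (unfold h, act; pose proof (cont_rot a0 b0); cont).
  pose proof (cont_latitude_int h Ch) as Cl.
  assert (Hrho : 0 <= rho).
  { unfold rho; destruct x as [[x1 x2] x3]; apply sqrt_pos. }
  assert (M : latitude_int h rho 1 + latitude_int h rho (-1) = 0).
  { apply even_moments_endpoint; [cont |]; intros n.
    transitivity (moment (latitude_int h rho) (2 * n) 0);
      [| apply (moments_vanish h e1 e Ch He)].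
    - apply RInt_extR; intros b; ring.
    - intros y Hy; apply Hg; now rewrite norm3_rot.
    - intros r a b Hr _ _.
      destruct (apple_rot g a0 b0 r a b Cg) as (a' & b' & Ha & Hb & E).
      unfold h; rewrite E; now apply HA.
    - lra. }
  rewrite !latitude_int_pole in M by ring.
  assert (E2 : opp3 x = rot a0 b0 (0, 0, rho * -1)).
  { rewrite Ex; unfold rot; simpl; triple; ring. }
  rewrite E2, Ex; rewrite Rmult_1_r in M.
  change (h (0, 0, rho) + h (0, 0, rho * -1) = 0).
  pose proof PI_RGT_0; apply (Rmult_eq_reg_l (2 * PI)); lra.
Qed.

Lemma test_function_zero D f x : test_function D f -> ~ D x -> f x = 0.
Proof.
  intros (_ & _ & H) N; apply NNPP; intros F; apply N, H.
  intros P HP; exists x; split; [now apply locally_singleton | exact F].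
Qed.

(** At a point of the support the function is smooth; around any other point it
    is locally zero. *)
Lemma test_function_cont D f : test_function D f -> cont f.
Proof.
  intros (Hs & _ & HD) x.
  destruct (classic (support f x)) as [S | S]; [apply (Hs O), HD, S |].
  apply not_all_ex_not in S; destruct S as [P S].
  apply imply_to_and in S; destruct S as [HP S].
  apply continuous_ext_loc with (fun _ => 0); [| apply continuous_const].
  revert HP; apply filter_imp; intros y Hy; symmetry.
  apply NNPP; intros F; apply S; now exists y.
Qed.

Lemma apple_minus f1 f2 r a b : cont f1 -> cont f2 ->
  apple (fun x => f1 x - f2 x) r a b = apple f1 r a b - apple f2 r a b.
Proof.
  intros C1 C2; pose proof (cont_apple_weight r) as Cw.
  pose proof (cont_apple_radius r) as Cr.
  assert (Cp : forall f, cont f -> cont (fun z : R * R => apple_weight r (snd z)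
    * polar (act (rot a b) f) (apple_radius r (snd z)) (fst z) (snd z))).
  { intros f Cf; unfold polar, act, rot, rotU, rotV; cont. }
  pose proof (Cp f1 C1) as K1; pose proof (Cp f2 C2) as K2.
  unfold apple; fold (apple_weight r) in *.
  set (k := fun f t p => apple_weight r p
    * polar (act (rot a b) f) (apple_radius r p) t p).
  change (RInt (fun t => RInt (k (fun x => f1 x - f2 x) t) 0 PI) 0 (2 * PI)
    = RInt (fun t => RInt (k f1 t) 0 PI) 0 (2 * PI)
      - RInt (fun t => RInt (k f2 t) 0 PI) 0 (2 * PI)).
  assert (Ck1 : cont (fun z => k f1 (fst z) (snd z))) by exact K1.
  assert (Ck2 : cont (fun z => k f2 (fst z) (snd z))) by exact K2.
  rewrite <- RInt_minusR by (apply cont_RInt; assumption).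
  apply RInt_extR; intros t.
  rewrite <- RInt_minusR by (set (k1 := k f1) in *; set (k2 := k f2) in *; cont).
  apply RInt_extR; intros p; unfold k, polar, act; ring.
Qed.

Theorem theorem5 (eps1 eps2 eps delta : R) (f1 f2 : R3 -> R)
  (heps1 : 1 < eps1) (heps12 : eps1 < eps2)
  (hf1 : test_function
           (fun x => hollow_ball eps1 eps2 x /\ upper_half_space x) f1)
  (hf2 : test_function
           (fun x => hollow_ball eps1 eps2 x /\ upper_half_space x) f2)
  (heps : eps1 <= eps <= eps2)
  (hdelta : delta = (eps ^ 2 - 1) / (2 * eps))
  (hA : forall r alpha beta : R,
      0 <= r <= delta -> 0 <= alpha <= 2 * PI -> 0 <= beta <= PI ->
      apple f1 r alpha beta = apple f2 r alpha beta) :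
  forall x : R3, 1 <= norm3 x <= eps -> f1 x = f2 x.
Proof.
  intros x Hx.
  pose proof (test_function_cont _ _ hf1) as C1.
  pose proof (test_function_cont _ _ hf2) as C2.
  set (g := fun x => f1 x - f2 x).
  assert (Cg : cont g) by (apply cont_minus; assumption).
  assert (g0 : forall y, ~ (hollow_ball eps1 eps2 y /\ upper_half_space y) ->
    g y = 0).
  { intros y Hy; unfold g.
    rewrite (test_function_zero _ _ _ hf1 Hy), (test_function_zero _ _ _ hf2 Hy).
    ring. }
  apply Rminus_diag_uniq; change (g x = 0).
  destruct (classic (upper_half_space x)) as [U | U]; [| apply g0; tauto].
  assert (K : g x + g (opp3 x) = 0).
  { apply (apple_kernel_odd g eps1 eps Cg); [lra | | | lra].
    - intros y Hy; apply g0; unfold hollow_ball; lra.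
    - intros r a b Hr Ha Hb; unfold g; rewrite apple_minus by assumption.
      rewrite hA by (rewrite ?hdelta; assumption); ring. }
  rewrite (g0 (opp3 x)) in K; [lra |].
  destruct x as [[x1 x2] x3]; simpl in *; lra.
Qed.
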